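(* Let $(M,\tau,\ell,\mathfrak m)$ be a metric measure spacetime and $f,g:M\to\bar{\mathbb R}$ non-negative and causal. Then $fg$ is causal and $$|\mathrm d(fg)|\ge f\,|\mathrm dg|+g\,|\mathrm df|\qquad\mathfrak m\text{-a.e. on }\mathrm{Vis}(M).$$
   Context: Conventions in $\bar{\mathbb R}=[-\infty,+\infty]$: $+\infty-(+\infty)=+\infty$, $-\infty-(-\infty)=+\infty$, $\pm\infty+z=\pm\infty$ for every $z\in\bar{\mathbb R}$, $0\cdot(\pm\infty)=0$. A time separation on a set $M$ is a map $\ell:M\times M\to\{-\infty\}\cup[0,+\infty]$ with $\ell(x,x)=0$ and $\min\{\ell(x,y)+\ell(y,z),\ell(y,z)+\ell(x,y)\}\le\ell(x,z)$; write $x\le y$ if $\ell(x,y)\ge0$. A metric measure spacetime $(M,\tau,\ell,\mathfrak m)$: $\tau$ is a Polish topology, $\ell$ a time separation with $\le$ a partial order and $\{\ell\ge0\}$ closed in $M^2$, $\mathfrak m$ a non-zero non-negative Radon measure. $\gamma:[0,1]\to M$ is causal if $s\le t$ implies $\gamma_s\le\gamma_t$. Its causal speed $|\dot\gamma_t|\in[0,+\infty]$ is the density of the absolutely continuous part (w.r.t. Lebesgue measure) of the largest Borel measure $\nu$ on $[0,1]$ with $\nu((a,b))\le\ell(\gamma_a,\gamma_b)$ for all $0\le a<b\le1$; for a.e. $t$ it equals $\lim_{h\downarrow0}\ell(\gamma_t,\gamma_{t+h})/h$. $\mathrm{LCC}([0,1];M)$ is the set of left-continuous causal curves with the topology of the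 distance $\mathsf D(\gamma,\eta)=\mathsf d(\gamma_0,\eta_0)+\int_0^1\mathsf d(\gamma_t,\eta_t)\,\mathrm dt$, $\mathsf d$ a bounded distance inducing $\tau$. $\mathsf e_t(\gamma):=\gamma_t$. A causal function is an $\mathfrak m$-measurable $f:M\to\bar{\mathbb R}$ such that $x\le y$ implies $f(x)\le f(y)$. A test plan is a Borel probability measure $\boldsymbol\pi$ on $\mathrm{LCC}([0,1];M)$ such that for some $C>0$, $(\mathsf e_t)_*\boldsymbol\pi\le C\mathfrak m$ for all $t\in[0,1]$. A Borel $G:M\to[0,+\infty]$ is a weak subslope of $f$ if $\int[f(\gamma_1)-f(\gamma_0)]\,\mathrm d\boldsymbol\pi\ge\iint_0^1G(\gamma_t)|\dot\gamma_t|\,\mathrm dt\,\mathrm d\boldsymbol\pi$ for every test plan $\boldsymbol\pi$; $|\mathrm df|$ denotes the $\mathfrak m$-a.e. largest weak subslope (it exists and is $\mathfrak m$-a.e. unique). For a test plan $\boldsymbol\pi$ let $\rho_{\boldsymbol\pi}$ be the $\mathfrak m$-density of the push-forward of the measure $|\dot\gamma_t|\,\mathrm d\boldsymbol\pi(\gamma)\,\mathrm dt$ on $\mathrm{LCC}([0,1];M)\times[0,1]$ under $(\gamma,t)\mapsto\gamma_t$. $\mathrm{Vis}(M)$ is the $\mathfrak m$-essential union of the sets $\{\rho_{\boldsymbol\pi}>0\}$ over all test plans $\boldsymbol\pi$ (the smallest Borel set, up to $\mathfrak m$-null sets, containing each of them up to $\mathfrak m$-null sets). *)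

(* Defs.v *)
From HB Require Import structures.
From mathcomp Require Import all_boot all_order all_algebra.
From mathcomp Require Import all_classical all_reals all_analysis.
From mathcomp Require Import measurable_realfun.

Set Implicit Arguments.
Unset Strict Implicit.
Unset Printing Implicit Defensive.

Import Order.TTheory GRing.Theory Num.Theory.
Import numFieldNormedType.Exports.
Local Open Scope classical_set_scope.
Local Open Scope ring_scope.
Local Open Scope ereal_scope.

(* In the sum the left summand wins whenever it is infinite; hence the sum is
   not commutative, and -oo - (-oo) below is not a sum of the form eadd x (- y).
   Products use the library's mule, for which 0 * (+/- oo) = 0. *)
Definition eadd (R : realType) (x y : \bar R) : \bar R :=
  if x is r%:E then r%:E + y else x.

Definition esub (R : realType) (x y : \bar R) : \bar R :=
  match x, y with
  | +oo, +oo => +oo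
  | -oo, -oo => +oo
  | _, _ => x - y
  end.

Section upper_integral.
Context d (T : measurableType d) (R : realType) (mu : {measure set T -> \bar R}).

(* Nothing in the definition of a metric measure spacetime makes the time
   separation Borel, so the integrals of the causal speed over a family of
   curves need not have measurable integrands. They are read as upper
   integrals, which give back the Lebesgue integral of measurable functions
   (upper_integralE) and require no additional hypothesis. *)
Definition upper_integral (phi : T -> \bar R) : \bar R :=
  ereal_inf [set \int[mu]_x h x |
    h in [set h : T -> \bar R | measurable_fun setT h /\ forall x, phi x <= h x]].

Lemma upper_integralE (phi : T -> \bar R) :
  measurable_fun setT phi -> (forall x, 0 <= phi x) ->
  upper_integral phi = \int[mu]_x phi x.
Proof.
move=> mphi phi0; apply/eqP; rewrite eq_le; apply/andP; split.
  by apply: ereal_inf_lbound; exists phi.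
apply: le_ereal_inf_tmp => _ [h [mh phih] <-].
by apply: ge0_le_integral => // x _; rewrite (le_trans (phi0 x)).
Qed.

End upper_integral.

Notation borel M := (g_sigma_algebraType (@open M)).

Section metrics.
Context (R : realType) (M : topologicalType) (d : M -> M -> R).
Local Open Scope ring_scope.

Definition is_distance : Prop :=
  [/\ forall x y, 0 <= d x y,
      forall x y, d x y = 0 <-> x = y,
      forall x y, d x y = d y x &
      forall x y z, d x z <= d x y + d y z].

Definition induces_topology : Prop :=
  forall (x : M) (U : set M),
    nbhs x U <-> exists2 e : R, 0 < e & [set y | d x y < e] `<=` U.

Definition distance_complete : Prop :=
  forall u : nat -> M,
    (forall e, 0 < e -> exists N, forall i j, (N <= i)%N -> (N <= j)%N ->
      d (u i) (u j) < e) ->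
    exists x : M, forall e, 0 < e -> exists N, forall i, (N <= i)%N ->
      d x (u i) < e.

Definition bounded_compatible_distance : Prop :=
  [/\ is_distance, induces_topology & exists C : R, forall x y, d x y <= C].

End metrics.

Definition polish (R : realType) (M : topologicalType) : Prop :=
  (exists2 S : set M, countable S & dense S) /\
  (exists d : M -> M -> R,
    [/\ is_distance d, induces_topology d & distance_complete d]).

Definition radon (R : realType) (M : ptopologicalType)
    (m : {measure set (borel M) -> \bar R}) : Prop :=
  (forall x : M, exists U : set M, [/\ open U, U x & m U < +oo]) /\
  (forall B : set (borel M), measurable B ->
    m B = ereal_sup [set m K | K in [set K : set M | compact K /\ K `<=` B]]).

Record time_separation (R : realType) (M : Type) := TimeSeparation {
  tsep :> M -> M -> \bar R;
  tsep_range : forall x y, tsep x y = -oo \/ 0 <= tsep x y;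
  tsep_refl : forall x, tsep x x = 0;
  tsep_triangle : forall x y z,
    Order.min (eadd (tsep x y) (tsep y z)) (eadd (tsep y z) (tsep x y))
      <= tsep x z }.

Definition causal_le (R : realType) (M : Type) (l : time_separation R M)
  (x y : M) : Prop := 0 <= l x y.

Definition metric_measure_spacetime (R : realType) (M : ptopologicalType)
    (l : time_separation R M) (m : {measure set (borel M) -> \bar R}) : Prop :=
  [/\ polish R M,
      [/\ forall x, causal_le l x x,
          forall x y, causal_le l x y -> causal_le l y x -> x = y &
          forall x y z, causal_le l x y -> causal_le l y z -> causal_le l x z],
      closed [set p : M * M | 0 <= l p.1 p.2],
      radon m &
      m setT != 0].

Section left_continuous_causal_curves.
Context (R : realType) (M : ptopologicalType) (l : time_separation R M).
Local Open Scope ring_scope.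

(* A curve [0, 1] -> M is encoded by its extension to R that is constant on
   each side of [0, 1], so that equality in LCC is equality on [0, 1]. *)
Record LCC := MkLCC {
  curve :> R -> M;
  curve_clamp : forall t, curve t = curve (Num.max 0 (Num.min t 1));
  curve_causal : forall s t, 0 <= s -> s <= t -> t <= 1 ->
    causal_le l (curve s) (curve t);
  curve_left_continuous : forall t, 0 < t -> t <= 1 ->
    curve x @[x --> t^'-] --> curve t }.

Lemma cst_clamp t : (cst point : R -> M) t =
  (cst point : R -> M) (Num.max 0 (Num.min t 1)).
Proof. by []. Qed.

Lemma cst_causal s t : 0 <= s -> s <= t -> t <= 1 ->
  causal_le l ((cst point : R -> M) s) ((cst point : R -> M) t).
Proof. by rewrite /causal_le tsep_refl. Qed.

Lemma cst_left_continuous t : 0 < t -> t <= 1 ->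
  (cst point : R -> M) x @[x --> t^'-] --> (cst point : R -> M) t.
Proof. by move=> _ _; exact: cvg_cst. Qed.

HB.instance Definition _ := gen_eqMixin LCC.
HB.instance Definition _ := gen_choiceMixin LCC.
HB.instance Definition _ :=
  isPointed.Build LCC (MkLCC cst_clamp cst_causal cst_left_continuous).

Definition LCC_dist (d : M -> M -> R) (c c' : LCC) : R :=
  d (c 0) (c' 0) +
  \int[@lebesgue_measure R]_(t in `[0, 1]) d (c t) (c' t).

Definition LCC_open (d : M -> M -> R) : set (set LCC) :=
  [set U | forall c, U c ->
    exists2 e : R, 0 < e & [set c' | LCC_dist d c c' < e] `<=` U].

End left_continuous_causal_curves.

Notation borel_LCC l d := (g_sigma_algebraType (LCC_open (l := l) d)).

Section causal_speed.
Context (R : realType) (M : ptopologicalType) (l : time_separation R M).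

Notation borel_measure := {measure set (measurableTypeR R) -> \bar R}.

(* A Borel measure on [0, 1] is a Borel measure on R vanishing off [0, 1]. *)
Definition measure_below_tsep (c : R -> M) (nu : borel_measure) : Prop :=
  nu (~` `[0%R, 1%R]%classic) = 0 /\
  forall a b : R, (0 <= a)%R -> (a < b)%R -> (b <= 1)%R ->
    nu `]a, b[%classic <= l (c a) (c b).

Definition largest_measure (P : borel_measure -> Prop) (nu : borel_measure) :=
  P nu /\ forall nu' : borel_measure, P nu' ->
    forall A, measurable A -> nu' A <= nu A.

(* The absolutely continuous part of nu is the largest absolutely continuous
   measure below nu. It is the one of the Lebesgue decomposition of nu whenever
   there is such a decomposition, and still makes sense when nu is not
   sigma-finite and has none (for instance if l (c a) (c b) = +oo for all
   a < b, in which case the speed is +oo). *)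
Definition ac_part (nu mu : borel_measure) : Prop :=
  largest_measure (fun mu' : borel_measure =>
    (forall A, measurable A -> mu' A <= nu A) /\
    (forall A, measurable A -> @lebesgue_measure R A = 0 -> mu' A = 0)) mu.

Definition is_causal_speed (c : R -> M) (v : R -> \bar R) : Prop :=
  exists nu mu : borel_measure,
    [/\ largest_measure (measure_below_tsep c) nu,
        ac_part nu mu,
        measurable_fun setT v,
        forall t, 0 <= v t &
        forall A, measurable A ->
          mu A = \int[@lebesgue_measure R]_(t in A `&` `[0%R, 1%R]) v t].

(* Only the class of causal_speed c modulo equality a.e. on [0, 1] matters. *)
Definition causal_speed (c : R -> M) : R -> \bar R :=
  xget (cst 0) [set v | is_causal_speed c v].

End causal_speed.

Section causal_calculus.
Context (R : realType) (M : ptopologicalType) (l : time_separation R M)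
  (m : {measure set (borel M) -> \bar R}) (d : M -> M -> R).

Definition m_measurable (f : M -> \bar R) : Prop :=
  forall B : set (\bar R), measurable B -> completed_algebra_gen m (f @^-1` B).

Definition causal_function (f : M -> \bar R) : Prop :=
  m_measurable f /\ forall x y, causal_le l x y -> f x <= f y.

Definition test_plan (pi : probability (borel_LCC l d) R) : Prop :=
  exists2 C : R, (0 < C)%R & forall t : R, (0 <= t <= 1)%R ->
    forall B : set (borel M), measurable B ->
      pushforward pi (fun c : borel_LCC l d => c t : borel M) B <= C%:E * m B.

Definition speed_integral (pi : probability (borel_LCC l d) R)
    (G : M -> \bar R) : \bar R :=
  upper_integral pi (fun c : borel_LCC l d =>
    \int[@lebesgue_measure R]_(t in `[0%R, 1%R]) (G (c t) * causal_speed l c t)).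

Definition weak_subslope (f G : M -> \bar R) : Prop :=
  [/\ measurable_fun setT (G : borel M -> \bar R),
      forall x, 0 <= G x &
      forall pi : probability (borel_LCC l d) R, test_plan pi ->
        speed_integral pi G <= \int[pi]_c esub (f (c 1%R)) (f (c 0%R))].

(* D is a version of |df|, the m-a.e. largest weak subslope of f. *)
Definition largest_weak_subslope (f D : M -> \bar R) : Prop :=
  weak_subslope f D /\
  forall G, weak_subslope f G -> {ae m, forall x, G x <= D x}.

(* rho is a version of the density rho_pi. *)
Definition visible_density (pi : probability (borel_LCC l d) R)
    (rho : M -> \bar R) : Prop :=
  [/\ measurable_fun setT (rho : borel M -> \bar R),
      forall x, 0 <= rho x &
      forall B : set (borel M), measurable B ->
        \int[m]_(x in B) rho x = speed_integral pi (fun x => (\1_B x)%:E)].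

Definition contains_visible (V : set (borel M)) : Prop :=
  measurable V /\
  forall pi rho, test_plan pi -> visible_density pi rho ->
    m.-negligible ([set x | 0 < rho x] `\` V).

(* V is a version of Vis(M). *)
Definition is_Vis (V : set (borel M)) : Prop :=
  contains_visible V /\
  forall W, contains_visible W -> m.-negligible (V `\` W).

End causal_calculus.

(* Main.v *)
(** Proof idea. It is enough to show that a Borel representative of
    f |dg| + g |df| is a weak subslope of f g. Replacing a curve c by the curve
    stopped outside [s, t] (frozen at c s before s, at c t after t) and
    restricting a test plan to a Borel set of curves produces new test plans, so
    the integrated inequality defining |df| localizes: for every test plan, almost
    every curve c satisfies
      f (c t) - f (c s) >= \int_s^t |df|(c r) |c'_r| dr
    for all s < t of the form k/(n+1), (k+1)/(n+1). Along such a curve,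
    F = f o c and G = g o c are nondecreasing, and
      F(t)G(t) - F(s)G(s) >= F(s)(G(t) - G(s)) + G(s)(F(t) - F(s));
    summing over the grid and letting n go to infinity with Fatou's lemma, where
    F and G at the grid point just before r tend to F r and G r except for
    countably many r, gives the inequality for f g along c. *)
Require Import Defs.
From HB Require Import structures.
From mathcomp Require Import all_boot all_order all_algebra.
From mathcomp Require Import all_classical all_reals all_analysis.
From mathcomp Require Import measurable_realfun.
From mathcomp Require Import ring lra.
Set Implicit Arguments.
Unset Strict Implicit.
Unset Printing Implicit Defensive.
Import Order.TTheory GRing.Theory Num.Theory.
Import numFieldNormedType.Exports.
Local Open Scope classical_set_scope.
Local Open Scope ring_scope.
Local Open Scope ereal_scope.

(** * Borel structure of the space of curves *)

(** Two measurability obstacles shape the localization. The integral of [G] times the speed is not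
    known to be a measurable function of the curve, so the set of curves with increment of [f] at
    most p and integral above q cannot simply be conditioned on. It is covered by a Borel set [B] of
    curves with increment at most p; the inequality for the plan conditioned on [B] and stopped
    yields a smaller cover, by a factor (p + q) / (2 q) < 1, and iterating makes the outer measure
    vanish. Moreover [f] and [g] are Borel only off an [m]-null set; a test plan does not charge it
    at any fixed time, so by Fubini almost every curve spends Lebesgue-null time in it. Stopping has
    to be a Borel map on the space of curves, although evaluation at a positive time need not be
    continuous there; hence the initial study of evaluations and of a countable base. Finally, the
    speed is only defined through a largest measure, so the one of the stopped curve is exhibited
    explicitly, the reverse triangle inequality serving to glue interval bounds across s and t. *)

Section grid.
Context (R : realType).
Implicit Types (n : nat) (t : R).
Local Open Scope ring_scope.

(* [grid n t] is the last multiple of 1/(n+1) strictly before [t]. *)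
Definition grid_index n t : int := Num.ceil (n.+1%:R * t) - 1.
Definition grid n t : R := (grid_index n t)%:~R / n.+1%:R.

Lemma grid_indexE n t (k : int) : (grid_index n t == k) =
  (k%:~R / n.+1%:R < t <= (k + 1)%:~R / n.+1%:R).
Proof.
rewrite /grid_index subr_eq Num.Theory.ceil_eq addrK.
by rewrite ltr_pdivrMr // ler_pdivlMr // (mulrC t).
Qed.

Lemma grid_itv n t : grid n t < t <= grid n t + n.+1%:R^-1.
Proof.
have : grid_index n t == grid_index n t by [].
by rewrite grid_indexE intrD mulrDl div1r.
Qed.

Lemma grid_itvP n (k : nat) t : t \in `]k%:R / n.+1%:R, k.+1%:R / n.+1%:R]%R ->
  grid n t = k%:R / n.+1%:R.
Proof.
rewrite in_itv /= => h; rewrite /grid; congr (_ / _).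
by have /eqP -> : grid_index n t == k by rewrite grid_indexE (addrC k%:Z) -intS.
Qed.

Lemma measurable_grid_index n (k : int) :
  measurable [set t : R | grid_index n t = k].
Proof.
rewrite (_ : [set t | _] = `]k%:~R / n.+1%:R, (k + 1)%:~R / n.+1%:R]%classic) //.
apply/seteqP; split=> t /=; rewrite in_itv /= -grid_indexE; first by move=> ->.
by move/eqP.
Qed.

Lemma measurable_fun_grid_index dT (T : measurableType dT) n (h : int -> T) :
  measurable_fun setT ((fun t => h (grid_index n t)) : measurableTypeR R -> T).
Proof.
move=> _ B mB; rewrite setTI.
rewrite (_ : _ @^-1` _ = \bigcup_(k in [set k | B (h k)]) [set t : R | grid_index n t = k]).
  rewrite bigcup_mkcond; apply: countable_bigcupT_measurable => [|k]; first exact: countableP.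
  by case: ifP => // _; exact: measurable_grid_index.
apply/seteqP; split=> [t /= hB|t [k /= hB hk]]; first by exists (grid_index n t).
by rewrite hk.
Qed.

(** The strict inequality [grid n t < t] places the sequence in the left punctured filter, so that
    left-continuity alone controls a curve along its grid points. *)
Lemma cvg_grid t : grid n t @[n --> \oo] --> t^'-.
Proof.
move=> A /nbhs_ballP[e /= e0 eA].
have := near_infty_natSinv_lt (PosNum e0); apply: filterS => n /= ne.
have /andP[g1 g2] := grid_itv n t.
apply: eA => //; rewrite /ball /= gtr0_norm ?subr_gt0 //.
by rewrite (le_lt_trans _ ne) // lerBlDl.
Qed.

Lemma cvg_comp_grid (Y : topologicalType) (h : R -> Y) t :
  h s @[s --> t^'-] --> h t -> h (grid n t) @[n --> \oo] --> h t.
Proof. by move=> ht A hA; exact: cvg_grid (ht _ hA). Qed.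

End grid.

(** * Measurability of maps into a separable metric space *)

Section metric_borel.
Context (R : realType) (M : ptopologicalType) (d : M -> M -> R).
Hypotheses (dd : is_distance d) (dtop : induces_topology d).
Context (xd : nat -> M)
  (xdP : forall x (e : R), (0 < e)%R -> exists k, (d (xd k) x < e)%R).
Local Open Scope ring_scope.

Lemma dist_ge0 x y : 0 <= d x y. Proof. by case: dd. Qed.
Lemma distxx x : d x x = 0. Proof. by case: dd => _ /(_ x x)[_ ->]. Qed.
Lemma distC x y : d x y = d y x. Proof. by case: dd. Qed.
Lemma dist_triangle y x z : d x z <= d x y + d y z. Proof. by case: dd. Qed.

Lemma dist_lipschitz x y z : `|d x y - d x z| <= d y z.
Proof.
rewrite ler_norml lerNl opprB !lerBlDr addrC dist_triangle /=.
by rewrite addrC (distC y z) dist_triangle.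
Qed.

Lemma dist_lipschitz2 x y x' y' : `|d x y - d x' y'| <= d x x' + d y y'.
Proof.
rewrite (_ : d x y - d x' y' = (d y x - d y x') + (d x' y - d x' y')).
  by rewrite (le_trans (ler_normD _ _)) // lerD // dist_lipschitz.
by rewrite (distC y x) (distC y x') addrA subrK.
Qed.

Lemma cvg_dist (T : Type) (F : set_system T) {FF : Filter F} (u v : T -> M) x y :
  u t @[t --> F] --> x -> v t @[t --> F] --> y ->
  d (u t) (v t) @[t --> F] --> d x y.
Proof.
move=> ux vy; apply/cvgrPdist_lt => e e0.
have e20 : 0 < e / 2 by rewrite divr_gt0.
have nx : nbhs x [set z | d x z < e / 2] by apply/dtop; exists (e / 2).
have ny : nbhs y [set z | d y z < e / 2] by apply/dtop; exists (e / 2).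
have hx : F [set t | d x (u t) < e / 2] := ux _ nx.
have hy : F [set t | d y (v t) < e / 2] := vy _ ny.
apply: filterS2 hx hy => t /= h1 h2.
by rewrite (le_lt_trans (dist_lipschitz2 _ _ _ _)) // (splitr e) ltrD.
Qed.

Lemma open_ball_cover (U : set M) : open U -> exists I : set (nat * nat),
  U = \bigcup_(i in I) [set y | d (xd i.1) y < i.2.+1%:R^-1].
Proof.
move=> oU; exists [set i | [set y | d (xd i.1) y < i.2.+1%:R^-1] `<=` U].
apply/seteqP; split=> [x Ux|x [i /= iU]]; last exact: iU.
have /dtop[e e0 eU] : nbhs x U by exact: open_nbhs_nbhs.
have e20 : 0 < e / 2 by rewrite divr_gt0.
have [n _ /(_ n (leqnn n)) /= nP] := near_infty_natSinv_lt (PosNum e20).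
have [k kP] := @xdP x n.+1%:R^-1 (ltac:(by rewrite invr_gt0)).
exists (k, n) => //= y /= ky; apply: eU => /=.
rewrite (le_lt_trans (dist_triangle (xd k) _ _)) // (splitr e) ltrD //.
  by rewrite distC (lt_trans kP).
exact: lt_trans ky nP.
Qed.

(** By separability every open set is a countable union of balls centred at the [xd k], so
    measurability into [M] reduces to real-valued functions. *)
Lemma measurable_fun_dist dT (T : measurableType dT) (X : T -> M) :
  (forall x, measurable_fun setT (fun w => d x (X w))) ->
  measurable_fun setT (X : T -> borel M).
Proof.
move=> mX; apply: (@measurability _ _ T (borel M) setT X (@open M)) => // _ [U /= oU <-].
have [I ->] := open_ball_cover oU.
rewrite setTI preimage_bigcup bigcup_mkcond.
apply: countable_bigcupT_measurable => [|i]; first exact: countableP.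
case: ifP => // _.
rewrite (_ : _ @^-1` _ = setT `&` (fun w => d (xd i.1) (X w)) @^-1` `]-oo, i.2.+1%:R^-1[%classic).
  by apply: mX.
by rewrite setTI; apply/seteqP; split => w /=; rewrite in_itv.
Qed.

Lemma open_dist_lt x (a : R) : open [set y | d x y < a].
Proof.
rewrite openE => y /= ya; apply/dtop; exists (a - d x y); first by rewrite /= subr_gt0.
move=> z /=; rewrite ltrBrDl; exact: le_lt_trans (dist_triangle y x z).
Qed.

Lemma measurable_dist x : measurable_fun setT (d x : borel M -> R).
Proof.
move=> mT; apply: (measurability _ (RGenInftyO.measurableE R)) => // _ [_ [a ->] <-].
rewrite setTI preimage_itvNyo; apply: sub_sigma_algebra; exact: open_dist_lt.
Qed.

Lemma measurable_dist2 dT (T : measurableType dT) (X Y : T -> borel M) :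
  measurable_fun setT X -> measurable_fun setT Y ->
  measurable_fun setT (fun w => d (X w) (Y w)).
Proof.
move=> mX mY mT; apply: (measurability _ (RGenInftyO.measurableE R)) => // _ [_ [a ->] <-].
rewrite setTI preimage_itvNyo.
(* Going through a point [xd k] close to [X w] decouples the two variables, so no Borel structure on
   [M * M] is involved. *)
rewrite (_ : [set w | _] = \bigcup_k [set w | d (xd k) (X w) + d (xd k) (Y w) < a]).
  apply: bigcup_measurable => k _; rewrite -preimage_itvNyo -[X in measurable X]setTI.
  by apply: measurable_funD => //; apply: measurableT_comp => //; exact: measurable_dist.
apply/seteqP; split=> w /= => [wa|[k _ /=]].
  have e0 : 0 < (a - d (X w) (Y w)) / 2 by rewrite divr_gt0 // subr_gt0.
  have [k kP] := xdP (X w) e0; exists k => //=.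
  rewrite (le_lt_trans (lerD (lexx _) (dist_triangle (X w) _ _))) //.
  by move: kP; lra.
by apply: le_lt_trans; rewrite (distC (xd k)) dist_triangle.
Qed.

(** The map is the pointwise limit of its values at grid times. For fixed n these depend on time
    only through the countably valued [grid_index], hence are jointly measurable. *)
Lemma measurable_left_continuous dT (T : measurableType dT) (X : T -> R -> M) :
  (forall w t, X w s @[s --> t^'-] --> X w t) ->
  (forall q, measurable_fun setT ((fun w => X w q) : T -> borel M)) ->
  measurable_fun setT ((fun p => X p.1 p.2) : T * measurableTypeR R -> borel M).
Proof.
move=> Xlc mX; apply: measurable_fun_dist => x.
apply: (@measurable_fun_cvg _ _ _ _ (fun n (p : T * measurableTypeR R) => d x (X p.1 (grid n p.2)))).
  move=> n; apply: (measurableT_comp (measurable_dist x)).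
  move=> _ B mB; rewrite setTI.
  rewrite (_ : _ @^-1` _ = \bigcup_(k : int)
     (((fun w => X w (k%:~R / n.+1%:R)) @^-1` B) `*` [set t : R | grid_index n t = k])).
    apply: countable_bigcupT_measurable; first exact: countableP.
    move=> k; apply: measurableX; last exact: measurable_grid_index.
    by rewrite -[X in measurable X]setTI; exact: mX.
  apply/seteqP; split=> [[w t] /= h|[w t] /= [k _ [/= h kE]]]; last by rewrite /grid kE.
  by exists (grid_index n t).
move=> [w t] _ /=; apply: cvg_dist; first exact: cvg_cst.
exact: cvg_comp_grid (Xlc w t).
Qed.

End metric_borel.

(** * Evaluations and a countable base for [LCC] *)

Section LCC_borel.
Context (R : realType) (M : ptopologicalType) (l : time_separation R M).
Context (d : M -> M -> R).
Hypotheses (dd : is_distance d) (dtop : induces_topology d).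
Context (C : R) (dC : forall x y, (d x y <= C)%R).
Context (xd : nat -> M)
  (xdP : forall x (e : R), (0 < e)%R -> exists k, (d (xd k) x < e)%R).
Local Open Scope ring_scope.
Local Notation mu := (@lebesgue_measure R).
Implicit Types c : LCC l.

Lemma LCC_left_continuous c t : c s @[s --> t^'-] --> c t.
Proof.
have [t0|t0] := leP t 0.
  apply: cvg_near_cst; near=> s.
  have st : s < t by near: s; exact: nbhs_left_lt.
  rewrite (curve_clamp c s) (curve_clamp c t); congr (c _).
  by rewrite !(min_idPl _) ?max_l //; lra.
have [t1|t1] := leP t 1; first exact: curve_left_continuous.
apply: cvg_near_cst; near=> s.
have st : 1 < s by near: s; exact: nbhs_left_gt.
rewrite (curve_clamp c s) (curve_clamp c t); congr (c _).
by rewrite !(min_idPr _) //; lra.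
Unshelve. all: by end_near. Qed.

Lemma measurable_LCC c : measurable_fun setT (c : measurableTypeR R -> borel M).
Proof.
have h := @measurable_left_continuous R M d dd dtop xd xdP _ (measurableTypeR R)
  (fun _ => c) (fun _ t => @LCC_left_continuous c t) (fun q => @measurable_cst _ _ _ _ setT (c q : borel M)).
exact: (measurableT_comp h (measurable_fun_pair (@measurable_cst _ _ _ _ setT (0 : measurableTypeR R)) (@measurable_id _ _ setT))).
Qed.

Lemma integrable_dist (X Y : measurableTypeR R -> borel M) (D : set R) : measurable D ->
  D `<=` `[0, 1] ->
  measurable_fun setT X -> measurable_fun setT Y ->
  mu.-integrable D (EFin \o (fun t => d (X t) (Y t))).
Proof.
move=> mD D01 mX mY; apply: measurable_bounded_integrable => //.
- rewrite (@le_lt_trans _ _ (mu `[0, 1])) //; first by apply: le_measure => //; rewrite inE.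
  by rewrite lebesgue_measure_itv /= lte01 oppr0 adde0 ltry.
- by apply: measurable_funTS; apply: (measurable_dist2 dd dtop xdP).
- exists C; split; first exact: num_real.
  move=> K CK t _; rewrite /= ger0_norm ?(dist_ge0 dd) //.
  by rewrite (le_trans (dC _ _)) // ltW.
Qed.

Lemma integrable_cst01 (D : set R) (k : R) : measurable D -> D `<=` `[0, 1] ->
  mu.-integrable D (EFin \o (fun _ : R => k)).
Proof.
move=> mD D01; apply: measurable_bounded_integrable => //.
- rewrite (@le_lt_trans _ _ (mu `[0, 1])) //; first by apply: le_measure => //; rewrite inE.
  by rewrite lebesgue_measure_itv /= lte01 oppr0 adde0 ltry.
- by exists `|k|; split => // K kK t _ /=; rewrite ltW.
Qed.

Lemma Rintegral_dist_ge0 (D : set R) (X Y : R -> M) :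
  0 <= \int[mu]_(t in D) d (X t) (Y t).
Proof. by apply: Rintegral_ge0 => t _; exact: dist_ge0. Qed.

Lemma measurable_LCC_lipschitz (phi : LCC l -> R) :
  (forall c c', `|phi c - phi c'| <= LCC_dist d c c') ->
  measurable_fun setT (phi : borel_LCC l d -> R).
Proof.
move=> phiD mT; apply: (measurability _ (RGenInftyO.measurableE R)) => // _ [_ [a ->] <-].
rewrite setTI preimage_itvNyo; apply: sub_sigma_algebra => c /= ca.
exists (a - phi c) => [|c' /=]; first by rewrite /= subr_gt0.
rewrite ltrBrDl; apply: le_lt_trans; rewrite -lerBlDl.
by rewrite (le_trans (ler_norm _)) // distrC.
Qed.

Lemma LCC_dist_eval0 x c c' : `|d x (c 0) - d x (c' 0)| <= LCC_dist d c c'.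
Proof.
rewrite (le_trans (dist_lipschitz dd _ _ _)) // lerDl.
exact: Rintegral_dist_ge0.
Qed.

Lemma LCC_dist_integral x c c' (D : set (measurableTypeR R)) : measurable D -> D `<=` `[0, 1] ->
  `|\int[mu]_(t in D) d x (c t) - \int[mu]_(t in D) d x (c' t)| <= LCC_dist d c c'.
Proof.
move=> mD D01.
have mx : measurable_fun setT ((fun=> x) : measurableTypeR R -> borel M) by exact: measurable_cst.
have i1 (e : LCC l) : mu.-integrable D (EFin \o (fun t => d x (e t))).
  exact: (integrable_dist mD D01 mx (measurable_LCC e)).
have i2 := integrable_dist (@measurable_itv _ _) (@subset_refl _ _) (measurable_LCC c) (measurable_LCC c').
have i3 := integrable_dist mD D01 (measurable_LCC c) (measurable_LCC c').
have i4 : mu.-integrable D (EFin \o (fun t => d x (c t) - d x (c' t))).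
  exact: (@integrableB _ _ _ mu D mD _ _ (i1 c) (i1 c')).
rewrite -RintegralB // (le_trans (le_normr_Rintegral mD i4)) //.
have /le_trans := @le_Rintegral _ _ _ mu D (fun t => `|d x (c t) - d x (c' t)|) (fun t => d (c t) (c' t)) mD
  (integrable_norm i4) i3 (fun t _ => dist_lipschitz dd x (c t) (c' t)).
apply; rewrite /LCC_dist (@le_trans _ _ (\int[mu]_(t in `[0, 1]) d (c t) (c' t))) //; last first.
  by rewrite lerDr dist_ge0.
rewrite fine_le //; try exact: integrable_fin_num.
apply: ge0_subset_integral => //.
- exact: measurable_int i2.
- by move=> t _; rewrite lee_fin dist_ge0.
Qed.

(** The distance of curves controls the time 0 and integrals in time, but no single positive time.
    For q > 0, averages of [d x (c t)] over []a n, q]], an interval of length q / (n + 1), are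
    Lipschitz in the curve up to a constant factor, and by left-continuity they converge to
    [d x (c q)]. *)
Lemma measurable_eval_itv q : 0 <= q <= 1 ->
  measurable_fun setT ((fun c => c q) : borel_LCC l d -> borel M).
Proof.
move=> /andP[q0 q1]; apply: (measurable_fun_dist dd dtop xdP) => x.
have [{q0}q0|q0'] := ltP 0 q; last first.
  have -> : q = 0 by apply/eqP; rewrite eq_le q0' q0.
  by apply: measurable_LCC_lipschitz => c c'; exact: LCC_dist_eval0.
pose a n : R := q - q / n.+1%:R.
have aq n : a n < q by rewrite ltrBlDr ltrDl divr_gt0.
have a0 n : 0 <= a n by rewrite subr_ge0 ler_pdivrMr // ler_peMr ?ler1n // ltW.
have a01 n : `]a n, q] `<=` `[0, 1]%classic.
  move=> t /=; rewrite !in_itv /= => /andP[h1 h2].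
  by rewrite (le_trans h2 q1) (le_trans (a0 n) (ltW h1)).
have lea n : mu `]a n, q] = (q / n.+1%:R)%:E.
  by rewrite lebesgue_measure_itv /= lte_fin aq -EFinB /a opprB addrC subrK.
have mx : measurable_fun setT ((fun=> x) : measurableTypeR R -> borel M) by exact: measurable_cst.
pose A n (c : LCC l) := (q / n.+1%:R)^-1 * \int[mu]_(t in `]a n, q]) d x (c t).
apply: (@measurable_fun_cvg _ _ _ _ (fun n (c : borel_LCC l d) => A n c)).
  move=> n; apply: measurable_funM; first exact: measurable_cst.
  apply: measurable_LCC_lipschitz => c c'; exact: LCC_dist_integral.
move=> c _; apply/cvgrPdist_le => e e0.
have hl : d x (c s) @[s --> q^'-] --> d x (c q).
  by apply: (cvg_dist dd dtop); [exact: cvg_cst | exact: LCC_left_continuous].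
have /cvgrPdist_le/(_ e e0)/nbhs_ballP[r /= r0 rP] := hl.
have rq0 : 0 < r / q by rewrite divr_gt0.
have := near_infty_natSinv_lt (PosNum rq0); apply: filterS => n /=.
rewrite ltr_pdivlMr // mulrC => nr.
have hP t : t \in `]a n, q] -> `|d x (c q) - d x (c t)| <= e.
  rewrite in_itv /= => /andP[t1]; rewrite le_eqVlt => /predU1P[->|tq].
    by rewrite subrr normr0 ltW.
  apply: rP => //; rewrite /ball /= gtr0_norm ?subr_gt0 //.
  by rewrite (lt_trans _ nr) // ltrBlDr -ltrBlDl.
have w0 : 0 < q / n.+1%:R by rewrite divr_gt0.
have ih : mu.-integrable `]a n, q] (EFin \o (fun t => d x (c t))).
  exact: (integrable_dist _ (@a01 n) mx (measurable_LCC c)).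
have ic k : mu.-integrable `]a n, q] (EFin \o (fun _ : R => k)).
  exact: (integrable_cst01 _ _ (@a01 n)).
have h1 : (d x (c q) - e) * (q / n.+1%:R) <= \int[mu]_(t in `]a n, q]) d x (c t).
  rewrite (_ : _ * _ = \int[mu]_(t in `]a n, q]) (d x (c q) - e)).
    apply: le_Rintegral => // t /= ht; have := hP _ ht.
    by rewrite ler_norml => /andP[_]; rewrite lerBlDr addrC -lerBlDr.
  by rewrite Rintegral_cst //; congr (_ * _); rewrite [X in fine X]lea.
have h2 : \int[mu]_(t in `]a n, q]) d x (c t) <= (d x (c q) + e) * (q / n.+1%:R).
  rewrite (_ : _ * _ = \int[mu]_(t in `]a n, q]) (d x (c q) + e)).
    apply: le_Rintegral => // t /= ht; have := hP _ ht.
    by rewrite ler_norml => /andP[h _]; lra.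
  by rewrite Rintegral_cst //; congr (_ * _); rewrite [X in fine X]lea.
rewrite /A mulrC ler_norml; rewrite -(ler_pdivlMr _ _ w0) in h1; rewrite -(ler_pdivrMr _ _ w0) in h2.
set J := (_ / (q / n.+1%:R)) in h1 h2 *; clearbody J.
by apply/andP; lra.
Qed.

Lemma measurable_eval q : measurable_fun setT ((fun c => c q) : borel_LCC l d -> borel M).
Proof.
rewrite (_ : (fun c : LCC l => c q) = (fun c => c (Num.max 0 (Num.min q 1)))).
  by apply: measurable_eval_itv; rewrite le_max lexx /= ge_max ler01 ge_min lexx orbT.
by apply/funext => c; rewrite -curve_clamp.
Qed.

(* Step functions with values in the dense sequence are not causal, hence not
   elements of LCC, but balls around them still form a countable base. *)
Definition step_curve (i : nat * seq nat) (t : R) : M :=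
  xd (nth 0%N i.2 (absz (grid_index i.1 t))).

Definition step_dist (i : nat * seq nat) (c : LCC l) : R :=
  d (c 0) (xd (nth 0%N i.2 0%N)) +
  \int[mu]_(t in `]0, 1]) d (c t) (step_curve i t).

Lemma measurable_step_curve i : measurable_fun setT (step_curve i : measurableTypeR R -> borel M).
Proof.
exact: (@measurable_fun_grid_index R _ (borel M) i.1 (fun k => xd (nth 0%N i.2 (absz k)))).
Qed.

Lemma itvoc01_sub : `]0%R, 1%R] `<=` `[0%R, 1%R : R]%classic.
Proof. by move=> t /=; rewrite !in_itv /= => /andP[/ltW -> ->]. Qed.

Lemma LCC_dist_step i c c' : LCC_dist d c c' <= step_dist i c + step_dist i c'.
Proof.
have ms := measurable_step_curve i.
have i1 (e : LCC l) := integrable_dist (@measurable_itv _ `]0, 1]) itvoc01_sub (measurable_LCC e) ms.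
have i3 := integrable_dist (@measurable_itv _ `]0, 1]) itvoc01_sub (measurable_LCC c) (measurable_LCC c').
rewrite /LCC_dist /step_dist addrACA lerD //.
  by rewrite (distC dd (c' 0)) (dist_triangle dd).
rewrite -Rintegral_itv_obnd_cbnd // -RintegralD //; apply: le_Rintegral => //.
  exact: (@integrableD _ _ _ mu _ (@measurable_itv _ `]0, 1]) _ _ (i1 c) (i1 c')).
by move=> t _ /=; rewrite (distC dd (c' t)) (dist_triangle dd).
Qed.

(** Three errors of e / 3 are made: at the initial point; when [c t] is replaced by its value at the
    preceding grid point, which is small in mean by dominated convergence; and when the finitely
    many grid values are replaced by points of the dense sequence. *)
Lemma step_dist_dense c (e : R) : 0 < e -> exists i, step_dist i c < e.
Proof.
move=> e0; have e30 : 0 < e / 3 by rewrite divr_gt0.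
have mg n : measurable_fun setT ((fun t => c (grid n t)) : measurableTypeR R -> borel M).
  exact: (@measurable_fun_grid_index R _ (borel M) n (fun k => c (k%:~R / n.+1%:R))).
have m01 := @measurable_itv R `]0, 1].
have ig n := integrable_dist m01 itvoc01_sub (measurable_LCC c) (mg n).
have [||||| _ _] := @dominated_convergence _ _ R mu `]0, 1]%classic m01
  (fun n t => (d (c t) (c (grid n t)))%:E) (cst 0%E) (cst C%:E).
- by move=> n; exact: measurable_int (ig n).
- exact: measurable_cst.
- apply: aeW => t _; rewrite -[X in _ --> X]/(0%:E) -(distxx dd (c t)).
  apply: cvg_EFin; first by near=> n.
  apply: (cvg_dist dd dtop); first exact: cvg_cst.
  exact: cvg_comp_grid (@LCC_left_continuous c t).
- exact: (integrable_cst01 _ _ itvoc01_sub).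
- by apply: aeW => t n _; rewrite gee0_abs ?lee_fin ?(dist_ge0 dd).
rewrite integral_cst // mul0e => /fine_cvgP[_] /cvgrPdist_lt/(_ _ e30)[N _ /(_ N (leqnn N))].
rewrite /= sub0r normrN ger0_norm ?Rintegral_dist_ge0 // => IN.
have /choice[s sP] (k : nat) : exists j, d (c (k%:R / N.+1%:R)) (xd j) < e / 3.
  by have [j jP] := xdP (c (k%:R / N.+1%:R)) e30; exists j; rewrite (distC dd).
exists (N, mkseq s N.+1); rewrite /step_dist /=.
rewrite (_ : e = e / 3 + (e / 3 + e / 3)); last by lra.
rewrite ltrD //; first by have := sP 0%N; rewrite mul0r.
apply: (@le_lt_trans _ _ (\int[mu]_(t in `]0, 1]) (d (c t) (c (grid N t)) + e / 3))); last first.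
  rewrite RintegralD //.
    have l01 : mu `]0, 1]%classic = 1%:E.
      by rewrite lebesgue_measure_itv /= lte01 oppr0 adde0.
    rewrite Rintegral_cst // [X in fine X]l01 mulr1.
    by rewrite ltrD2r.
  exact: (integrable_cst01 _ _ itvoc01_sub).
apply: le_Rintegral => //.
- exact: (integrable_dist m01 itvoc01_sub (measurable_LCC c) (measurable_step_curve _)).
- have := @integrableD _ _ _ mu _ m01 _ _ (ig N) (_ : mu.-integrable `]0, 1] (EFin \o cst (e / 3))).
  apply.
  exact: (integrable_cst01 _ _ itvoc01_sub).
move=> t /=; rewrite in_itv /= => /andP[t0 t1].
rewrite (le_trans (dist_triangle dd (c (grid N t)) _ _)) // lerD2l.
(* For t in []0, 1]] the index runs from 0 to N, so [nth] never returns its default value on a list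
   of length N + 1. *)
have : 0 <= grid_index N t by rewrite subr_ge0 -gtz0_ge1 Num.Theory.ceil_gt0 mulr_gt0.
have : grid_index N t < N.+1%:Z.
  rewrite ltrBlDr ltzD1 Num.Theory.ceil_le_int -[leRHS]mulr1 ler_pM //; exact: ltW.
rewrite /step_curve /grid /=; case: (grid_index N t) => // k; rewrite ltz_nat => kN _ /=.
by rewrite nth_mkseq //; exact: ltW (sP k).
Unshelve. all: by end_near. Qed.

(** An open set of curves is a countable union of sublevel sets of the functions [step_dist i], by
    their density and the triangle inequality. Each [step_dist i (X w)] is measurable in w by
    Tonelli, since [X] is jointly measurable in w and time. *)
Lemma measurable_LCC_map dT (T : measurableType dT) (X : T -> LCC l) :
  (forall q, measurable_fun setT ((fun w => X w q) : T -> borel M)) ->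
  measurable_fun setT (X : T -> borel_LCC l d).
Proof.
move=> mX.
have mj := measurable_left_continuous dd dtop xdP (fun w t => @LCC_left_continuous (X w) t) mX.
have ms i : measurable_fun setT (fun w => step_dist i (X w)).
  apply: measurable_funD.
    exact: (measurable_dist2 dd dtop xdP (mX 0) (@measurable_cst _ _ T (borel M) setT _)).
  rewrite (_ : (fun w => _) = fine \o fubini_F mu (fun p : T * measurableTypeR R =>
     (\1_(`]0%R, 1%R]%classic) p.2 * d (X p.1 p.2) (step_curve i p.2))%:E)).
    apply: measurableT_comp => //; apply: measurable_fun_fubini_tonelli_F.
      apply/measurable_EFinP; apply: measurable_funM.
        by apply: measurableT_comp => //; exact: measurable_indic.
      apply: (measurable_dist2 dd dtop xdP mj).
      exact: (measurableT_comp (measurable_step_curve i) measurable_snd).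
    by move=> p; rewrite lee_fin mulr_ge0 // dist_ge0.
  apply/funext => w; rewrite /Rintegral /= /fubini_F [in LHS]integral_mkcond /=.
  congr fine; apply: eq_integral => t _; rewrite /patch indicE.
  by case: ifP => _; rewrite ?mul1r ?mul0r.
move=> mT; apply: (@measurability _ _ T (borel_LCC l d) setT X (LCC_open (l := l) d)) => //.
move=> _ [U /= oU <-].
rewrite setTI (_ : X @^-1` U = \bigcup_(i in [set i : (nat * seq nat) * nat |
    [set c | step_dist i.1 c < i.2.+1%:R^-1] `<=` U])
  [set w | step_dist i.1 (X w) < i.2.+1%:R^-1]).
  rewrite bigcup_mkcond; apply: countable_bigcupT_measurable => [|i]; first exact: countableP.
  case: ifP => // _.
  rewrite -preimage_itvNyo -[X in measurable X]setTI.
  exact: ms.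
apply/seteqP; split=> [w /= /oU[e e0 eU]|w [i /= iU]]; last exact: iU.
have e20 : 0 < e / 2 by rewrite divr_gt0.
have [n _ /(_ n (leqnn n)) /= nP] := near_infty_natSinv_lt (PosNum e20).
have [i iP] := @step_dist_dense (X w) n.+1%:R^-1 (ltac:(by rewrite invr_gt0)).
exists (i, n) => //= c /= ci; apply: eU => /=.
rewrite (le_lt_trans (LCC_dist_step i _ _)) // (splitr e) ltrD //.
  exact: lt_trans iP nP.
exact: lt_trans ci nP.
Qed.

End LCC_borel.

(** * Causal speed of stopped curves *)

Section measure_facts.
Context dT (T : measurableType dT) (R : realType) (mu : {measure set T -> \bar R}).

Lemma measure_subset (A B : set T) : measurable A -> measurable B -> A `<=` B ->
  mu A <= mu B.
Proof. by move=> mA mB AB; apply: le_measure; rewrite ?inE. Qed.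

Lemma measure0_subset (A B : set T) : measurable A -> measurable B -> A `<=` B ->
  mu B = 0 -> mu A = 0.
Proof.
move=> mA mB AB B0; apply/eqP; rewrite eq_le measure_ge0 andbT -B0.
exact: measure_subset.
Qed.

Lemma measure_setU_le (A B : set T) : measurable A -> measurable B ->
  mu (A `|` B) <= mu A + mu B.
Proof. exact: measureU2. Qed.

Lemma ereal_rat_between_fin (r : R) (y : \bar R) : r%:E < y ->
  exists p q : rat, [/\ (p < q)%R, (r < ratr p)%R & (ratr q)%:E < y].
Proof.
move=> ry; have [b rb bY] : exists2 b : R, (r < b)%R & b%:E <= y.
  case: y ry => [b| |] // rb; first by exists b.
  by exists (r + 1)%R; [rewrite ltrDl|rewrite leey].
have [p] := rat_in_itvoo rb; rewrite in_itv /= => /andP[rp pb].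
have [q] := rat_in_itvoo pb; rewrite in_itv /= => /andP[pq qb].
exists p, q; split => //; first by rewrite -(ltr_rat R).
by apply: lt_le_trans bY; rewrite lte_fin.
Qed.

Lemma ereal_rat_between (x y : \bar R) : 0 <= x -> x < y ->
  exists p q : rat, [/\ (p < q)%R, x < (ratr p)%:E & (ratr q)%:E < y].
Proof.
case: x => [r| |] // _ xy; last by move: xy; rewrite ltNge leey.
have [p [q [pq rp qy]]] := ereal_rat_between_fin xy.
by exists p, q; split => //; rewrite lte_fin.
Qed.

Lemma negligible_countable_bigcup (I : countType) (F : I -> set T) :
  (forall i, mu.-negligible (F i)) -> mu.-negligible (\bigcup_i F i).
Proof.
move=> FN; have := @negligible_bigcup _ _ _ mu (fun n => if unpickle n is Some i then F i else set0).
move=> /(_ _)/negligibleS; apply; last first.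
  by move=> n; case: unpickle => [i|]; [exact: FN|exact: negligible_set0].
by move=> x [i _ Fx]; exists (pickle i) => //; rewrite pickleK.
Qed.

(** Neither function has to be measurable: the set where [w < v] is a countable union over pairs of
    rationals separating the two values. This form is later applied to an integral of the speed as a
    function of the curve. *)
Lemma ae_le_rat (D : set T) (v w : T -> \bar R) : (forall x, 0 <= w x) ->
  (forall p q : rat, (p < q)%R -> mu.-negligible
     (D `&` [set x | w x <= (ratr p)%:E] `&` [set x | (ratr q)%:E < v x])) ->
  {ae mu, forall x, D x -> v x <= w x}.
Proof.
move=> w0 neg.
have := @negligible_countable_bigcup (rat * rat)%type (fun p => if (p.1 < p.2 :> rat)%R then
     (D `&` [set x | w x <= (ratr p.1)%:E] `&` [set x | (ratr p.2)%:E < v x])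
   else set0).
move=> /(_ _)/negligibleS; apply; last first.
  by move=> p; case: ifP => [pq|_]; [exact: neg|exact: negligible_set0].
move=> x /= /not_implyP[Dx /negP]; rewrite -ltNge => wv.
have [p [q [pq wp qv]]] := ereal_rat_between (w0 x) wv.
exists (p, q) => //; rewrite /= pq.
by split => //; split => //; exact: ltW.
Qed.

(** On the set E where [w <= p < q < v], the integral inequality gives q mu(E) <= p mu(E); as mu(E)
    is finite, it is zero. *)
Lemma ae_le_integral_subset (D : set T) (v w : T -> \bar R) :
  measurable D -> mu D < +oo ->
  measurable_fun setT v -> measurable_fun setT w -> (forall x, 0 <= w x) ->
  (forall A, measurable A -> \int[mu]_(x in A `&` D) v x <= \int[mu]_(x in A `&` D) w x) ->
  {ae mu, forall x, D x -> v x <= w x}.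
Proof.
move=> mD Dfin mv mw w0 vw; apply: ae_le_rat => // p q pq.
set E := (X in mu.-negligible X).
have mE : measurable E.
  apply: measurableI; first apply: measurableI => //.
    by rewrite -[X in measurable X]setTI; exact: emeasurable_fun_infty_c.
  by rewrite -[X in measurable X]setTI; exact: emeasurable_fun_o_infty.
apply/negligibleP => //; have [p0|p0] := ltP (ratr p : R) 0%R.
  rewrite (_ : E = set0) ?measure0 // -subset0 => x [[_ /= wp] _].
  by have := le_trans (w0 x) wp; rewrite lee_fin leNgt p0.
have ED : E `<=` D by move=> x [[]].
have Efin : mu E \is a fin_num.
  by rewrite ge0_fin_numE ?measure_ge0 // (le_lt_trans (measure_subset mE mD ED)).
have := vw _ mE; rewrite (_ : E `&` D = E); last exact/setIidPl.
move=> h.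
have h1 : (ratr q)%:E * mu E <= \int[mu]_(x in E) v x.
  rewrite -integral_cst //; apply: ge0_le_integral => //.
  - by move=> x _; rewrite lee_fin (le_trans p0) // ler_rat ltW.
  - exact: measurable_funTS.
  - by move=> x [_ /= /ltW].
have h2 : \int[mu]_(x in E) w x <= (ratr p)%:E * mu E.
  rewrite -integral_cst //; apply: ge0_le_integral => //.
  - exact: measurable_funTS.
  - by move=> x [[_ ?]].
have := le_trans h1 (le_trans h h2); rewrite -(fineK Efin) -!EFinM lee_fin -subr_le0 -mulrBl.
have qp : (0 < ratr q - ratr p :> R)%R by rewrite subr_gt0 ltr_rat.
rewrite pmulr_rle0 // => h3; suff E0 : mu E = 0 by exact: E0.
rewrite -(fineK Efin); congr (_%:E).
by apply/eqP; rewrite eq_le h3 fine_ge0 ?measure_ge0.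
Qed.

End measure_facts.

Section atom.
Context (R : realType).
Notation borel_measure := {measure set (measurableTypeR R) -> \bar R}.

(* [mscale] only takes finite weights. *)
Definition atom (x : R) (a : \bar R) : borel_measure :=
  if a is r%:E then mscale (NngNum (normr_ge0 r)) (dirac (x : measurableTypeR R))
  else mseries (fun _ => dirac (x : measurableTypeR R)) 0.

Lemma atom_notin x a A : measurable A -> ~ A x -> atom x a A = 0.
Proof.
move=> mA Ax; have d0 : \d_(x : measurableTypeR R) A = 0 :> \bar R by rewrite diracE memNset.
case: a => [r| |] /=; first by rewrite /mscale /= d0 mule0.
  by rewrite /mseries eseries0.
by rewrite /mseries eseries0.
Qed.

Lemma atom_in x a A : 0 <= a -> measurable A -> A x -> atom x a A = a.
Proof.
move=> a0 mA Ax; have d1 : \d_(x : measurableTypeR R) A = 1 :> \bar R by rewrite diracE mem_set.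
case: a a0 => [r| |] //=.
  by rewrite lee_fin => r0; rewrite /mscale /= d1 mule1 ger0_norm.
(* For the weight [+oo], the first [truncn r + 1] unit masses at x already exceed any given real
   r. *)
move=> _; apply/eqyP => r r0.
apply: (@le_trans _ _ (\sum_(0 <= k < (Num.truncn r).+1) \d_(x : measurableTypeR R) A)).
  by rewrite d1 sumEFin big_const_nat subn0 iter_addr_0 lee_fin ltW // Num.Theory.truncnS_gt.
exact: nneseries_lim_ge.
Qed.

End atom.

(** * Gluing interval bounds by the reverse triangle inequality *)

Section superadditivity.
Context (R : realType) (M : Type) (l : time_separation R M).

(** For nonnegative terms the one-sided sum [eadd] agrees with the usual commutative one, so the
    minimum in the axiom collapses. *)
Lemma tsep_superadditive x y z : causal_le l x y -> causal_le l y z ->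
  l x y + l y z <= l x z.
Proof.
rewrite /causal_le => xy yz; have := tsep_triangle l x y z.
have e u v : 0 <= u -> 0 <= v -> eadd u v = u + v :> \bar R.
  by case: u => [u| |] // _; case: v.
by rewrite !e // (addeC (l y z)) minxx.
Qed.

Context (c : R -> M) (nu : {measure set (measurableTypeR R) -> \bar R}).

(* An interval bound may be checked on the two sides of a point and on the
   point itself, as the open intervals on each side are exhausted by smaller
   ones, which leaves room to use the reverse triangle inequality. *)
Lemma le_tsep_split (a x b : R) :
  (forall s t, (a <= s)%R -> (s <= t)%R -> (t <= b)%R -> causal_le l (c s) (c t)) ->
  (forall a' b', (a <= a')%R -> (a' < b')%R -> (b' <= b)%R ->
     (b' <= x)%R \/ (x <= a')%R -> nu `]a', b'[%classic <= l (c a') (c b')) ->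
  (forall a' b', (a <= a')%R -> (a' < x)%R -> (x < b')%R -> (b' <= b)%R ->
     nu [set x] <= l (c a') (c b')) ->
  (a < b)%R -> nu `]a, b[%classic <= l (c a) (c b).
Proof.
move=> cc H1 H2 ab.
have [ax|] := ltP a x; last by move=> xa; apply: H1 => //; right.
have [xb|] := ltP x b; last by move=> bx; apply: H1 => //; left.
(* The denominator n + 2 keeps [e1 n] strictly between a and x, and [e2 n] strictly between x and b,
   already for n = 0. *)
pose e1 n : R := (x - (x - a) / n.+2%:R)%R.
pose e2 n : R := (x + (b - x) / n.+2%:R)%R.
have n2 n : (0 < (n.+2%:R^-1 : R) < 1)%R.
  by rewrite invr_gt0 ltr0n invf_lt1 ?ltr1n ?ltr0n.
have e1P n : (a < e1 n < x)%R.
  rewrite /e1; have /andP[h1 h2] := n2 n.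
  have : (0 < (x - a) * n.+2%:R^-1 < x - a)%R.
    by rewrite mulr_gt0 ?subr_gt0 //= gtr_pMr ?subr_gt0.
  by move: (_ / _)%R => q; lra.
have e2P n : (x < e2 n < b)%R.
  rewrite /e2; have /andP[h1 h2] := n2 n.
  have : (0 < (b - x) * n.+2%:R^-1 < b - x)%R.
    by rewrite mulr_gt0 ?subr_gt0 //= gtr_pMr ?subr_gt0.
  by move: (_ / _)%R => q; lra.
pose E n := `]a, e1 n[%classic `|` [set x] `|` `]e2 n, b[%classic.
have mE n : measurable (E n) by do 2 apply: measurableU => //.
have leE n : nu (E n) <= l (c a) (c b).
  have /andP[a1 x1] := e1P n; have /andP[x2 b2] := e2P n.
  have x12 : (e1 n < e2 n)%R by exact: lt_trans x1 x2.
  rewrite (le_trans (measure_setU_le _ _ _)) //; first exact: measurableU.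
  rewrite (@le_trans _ _ (l (c a) (c (e2 n)) + l (c (e2 n)) (c b))) //; last first.
    by apply: tsep_superadditive; apply: cc; lra.
  apply: leeD; last by apply: H1 => //; [lra|right; lra].
  rewrite (le_trans (measure_setU_le _ _ _)) //.
  rewrite (@le_trans _ _ (l (c a) (c (e1 n)) + l (c (e1 n)) (c (e2 n)))) //; last first.
    by apply: tsep_superadditive; apply: cc; lra.
  apply: leeD; first by apply: H1 => //; [lra|left; lra].
  by apply: H2 => //; lra.
have UE : \bigcup_n E n = `]a, b[%classic.
  apply/seteqP; split=> [y [n _]|y /=]; rewrite /E /=.
    have := e1P n; have := e2P n.
    by rewrite !in_itv /= => h1 h2 [[h|->]|h]; lra.
  rewrite in_itv /= => yab; have [yx|xy|->] := ltgtP y x; last by exists 0%N => //; left; right.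
    have h0 : (0 < (x - y) / (x - a))%R by rewrite divr_gt0 ?subr_gt0.
    have [n _ /(_ n (leqnn n)) /= nP] := near_infty_natSinv_lt (PosNum h0).
    exists n => //; left; left; rewrite /= in_itv /=; apply/andP; split; first lra.
    have : (n.+2%:R^-1 < (x - y) / (x - a))%R.
      by rewrite (le_lt_trans _ nP) // lef_pV2 ?posrE ?ltr0n // ler_nat.
    by rewrite ltr_pdivlMr ?subr_gt0 // /e1 (mulrC (x - a)%R); move: (_^-1 * _)%R => q; lra.
  have h0 : (0 < (y - x) / (b - x))%R by rewrite divr_gt0 ?subr_gt0.
  have [n _ /(_ n (leqnn n)) /= nP] := near_infty_natSinv_lt (PosNum h0).
  exists n => //; right; rewrite /= in_itv /=; apply/andP; split; last lra.
  have : (n.+2%:R^-1 < (y - x) / (b - x))%R.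
    by rewrite (le_lt_trans _ nP) // lef_pV2 ?posrE ?ltr0n // ler_nat.
  by rewrite ltr_pdivlMr ?subr_gt0 // /e2 (mulrC (b - x)%R); move: (_^-1 * _)%R => q; lra.
have ndE : nondecreasing_seq E.
  move=> m n mn; have i : (n.+2%:R^-1 <= m.+2%:R^-1 :> R)%R.
    by rewrite lef_pV2 ?posrE ?ltr0n // ler_nat.
  have i1 : (e1 m <= e1 n)%R by rewrite lerD2l lerN2 ler_wpM2l // subr_ge0 ltW.
  have i2 : (e2 n <= e2 m)%R by rewrite lerD2l ler_wpM2l // subr_ge0 ltW.
  apply/subsetPset => y; rewrite /E /= !in_itv /= => -[[h|->]|h].
  - by left; left; lra.
  - by left; right.
  - by right; lra.
have := nondecreasing_cvg_mu mE _ ndE (mu := nu); rewrite UE => /(_ (measurable_itv _)) nuE.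
rewrite -(cvg_lim _ nuE) //; apply: lime_le; first by apply/cvg_ex; eexists; exact: nuE.
by near=> n; exact: leE.
Unshelve. all: by end_near. Qed.

End superadditivity.

(** * The largest measure of a stopped curve *)

Section stopped_curve.
Context (R : realType) (M : ptopologicalType) (l : time_separation R M).
Context (c : R -> M) (s t : R).
Hypotheses (s0 : (0 <= s)%R) (st : (s < t)%R) (t1 : (t <= 1)%R).
Hypothesis cc : forall r r', (0 <= r)%R -> (r <= r')%R -> (r' <= 1)%R ->
  causal_le l (c r) (c r').
Notation borel_measure := {measure set (measurableTypeR R) -> \bar R}.
Local Notation leb := (@lebesgue_measure R).

Definition stop_time (r : R) : R := Num.max s (Num.min r t).

Lemma stop_time_le r : (r <= s)%R -> stop_time r = s.
Proof. by move=> rs; rewrite /stop_time max_l // ge_min rs. Qed.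

Lemma stop_time_ge r : (t <= r)%R -> stop_time r = t.
Proof. by move=> tr; rewrite /stop_time (min_idPr tr) max_r // ltW. Qed.

Lemma stop_time_id r : (s <= r <= t)%R -> stop_time r = r.
Proof. by move=> /andP[sr rt]; rewrite /stop_time (min_idPl rt) max_r. Qed.

Lemma stop_time_itv r : (s <= stop_time r <= t)%R.
Proof. by rewrite /stop_time le_max lexx /= ge_max (ltW st) ge_min lexx orbT. Qed.

Lemma stop_time_homo : {homo stop_time : x y / (x <= y)%R}.
Proof. by move=> x y xy; rewrite /stop_time; apply: le_max2 => //; exact: le_min2. Qed.

Definition stop : R -> M := c \o stop_time.

Lemma stop_causal r r' : (r <= r')%R -> causal_le l (stop r) (stop r').
Proof.
move=> rr; have /andP[h1 h2] := stop_time_itv r; have /andP[h3 h4] := stop_time_itv r'.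
by apply: cc; [exact: le_trans h1|exact: stop_time_homo|exact: le_trans t1].
Qed.

(* Freezing the curve changes the mass that a point s or t may carry, and the
   points 0 and 1 are subject to no constraint at all; these atoms are invisible
   to the absolutely continuous part. *)
Definition largest_atom (x : R) : \bar R :=
  Order.max 0 (ereal_sup [set nu [set x] | nu in measure_below_tsep l stop]).

Lemma largest_atom_le x a b : (0 <= a)%R -> (a < x)%R -> (x < b)%R -> (b <= 1)%R ->
  largest_atom x <= l (stop a) (stop b).
Proof.
move=> a0 ax xb b1; rewrite /largest_atom ge_max.
have ab : (a < b)%R by exact: lt_trans xb.
apply/andP; split; first by apply: stop_causal; exact: ltW.
apply: ge_ereal_sup => _ [nu [_ nuP] <-]; rewrite (le_trans _ (nuP _ _ a0 ab b1)) //.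
by apply: le_measure; rewrite ?inE //= => y ->; rewrite /= in_itv /= ax.
Qed.

Let measure_sumE (m1 m2 : borel_measure) A :
  (measure_add m1 m2 : borel_measure) A = m1 A + m2 A.
Proof. exact: measure_addE. Qed.

(** The explicit candidate for the largest measure of the stopped curve. If s = 0 or t = 1 two atoms
    sit at the same point; this is harmless, because no constrained interval []a, b[] contains 0 or
    1. *)
Definition stopped_measure (nu : borel_measure) : borel_measure :=
  measure_add (mrestr nu (measurable_itv `]s, t[))
    (measure_add (measure_add (atom 0%R (largest_atom 0%R)) (atom s (largest_atom s)))
                 (measure_add (atom t (largest_atom t)) (atom 1%R (largest_atom 1%R)))).

Lemma stopped_measureE nu A : stopped_measure nu A = nu (A `&` `]s, t[%classic) +
  (atom 0%R (largest_atom 0%R) A + atom s (largest_atom s) A +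
   (atom t (largest_atom t) A + atom 1%R (largest_atom 1%R) A)).
Proof. by rewrite /stopped_measure !measure_sumE. Qed.

Lemma stopped_measure_notin nu (A : set (measurableTypeR R)) : measurable A ->
  ~ A 0%R -> ~ A s -> ~ A t -> ~ A 1%R -> stopped_measure nu A = nu (A `&` `]s, t[%classic).
Proof. by move=> *; rewrite stopped_measureE !atom_notin // !adde0. Qed.

(** An interval avoiding s and t either lies where the stopped curve is constant and has measure
    zero, or lies in []s, t[] where [nu] is already bounded. The atoms at s and t satisfy the
    required bounds by [largest_atom_le]. *)
Lemma stopped_measure_below nu : measure_below_tsep l c nu ->
  measure_below_tsep l stop (stopped_measure nu).
Proof.
move=> [nu0 nuP]; split.
  have h (x : R) : (0 <= x <= 1)%R -> ~ (~` `[0%R, 1%R]%classic) x.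
    by move=> x01; apply; rewrite /= in_itv.
  rewrite stopped_measure_notin //; [|exact: measurableC|apply: h; move: s0 st t1; lra..].
  rewrite (_ : _ `&` _ = set0) ?measure0 // -subset0 => r [] /=; rewrite !in_itv /= => h1 h2.
  by apply: h1; move: s0 t1; lra.
clear nu0; move=> a b a0 ab b1.
have cst (x y : R) : (x <= y)%R -> 0 <= l (stop x) (stop y) by exact: stop_causal.
have nu_stop (x y : R) : (0 <= x)%R -> (x < y)%R -> (y <= 1)%R ->
    (y <= s)%R \/ (s <= x)%R -> (y <= t)%R \/ (t <= x)%R ->
    stopped_measure nu `]x, y[%classic <= l (stop x) (stop y).
  move=> x0 xy y1 xys xyt.
  rewrite stopped_measure_notin //; [|by rewrite /= in_itv /= => h; lra..].
  have [ys|sx] := leP y s.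
    rewrite (_ : _ `&` _ = set0) ?measure0 //; first by apply: cst; exact: ltW.
    by rewrite -subset0 => r [] /=; rewrite !in_itv /=; lra.
  have {}sx : (s <= x)%R by lra.
  have [tx|xt] := leP t x.
    rewrite (_ : _ `&` _ = set0) ?measure0 //; first by apply: cst; exact: ltW.
    by rewrite -subset0 => r [] /=; rewrite !in_itv /=; lra.
  rewrite /stop /= !stop_time_id; [|lra..].
  rewrite (le_trans _ (nuP x y x0 xy y1)) //.
  by apply: le_measure; rewrite ?inE; [exact: measurableI|exact: measurable_itv|exact: subIsetl].
have st_notin : ~ `]s, t[%classic s by rewrite /= in_itv /= ltxx.
have st_notin' : ~ `]s, t[%classic t by rewrite /= in_itv /= ltxx andbF.
have atom_stop (z x y : R) : z = s \/ z = t -> (0 <= x)%R -> (x < z)%R -> (z < y)%R -> (y <= 1)%R ->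
    stopped_measure nu [set z] <= l (stop x) (stop y).
  move=> zst x0 xz zy y1; have zP := largest_atom_le x0 xz zy y1.
  have zI : [set z] `&` `]s, t[%classic = set0.
    by rewrite -subset0 => r [/= ->]; case: zst => ->.
  have la0 u : 0 <= largest_atom u by rewrite /largest_atom le_max lexx.
  rewrite stopped_measureE zI measure0 add0e.
  rewrite (@atom_notin _ 0%R) //; last by move=> /= z0; lra.
  rewrite (@atom_notin _ 1%R) //; last by move=> /= z0; lra.
  rewrite add0e adde0; case: zst zP => -> zP.
    rewrite atom_in // atom_notin ?adde0 //; move=> /= h; move: st; lra.
  rewrite atom_notin ?add0e ?atom_in //; move=> /= h; move: st; lra.
(* The interval is split at s and each piece again at t; what remains are intervals containing
   neither point, and the two singletons. *)
apply: (@le_tsep_split _ _ _ _ _ a s b) => // [x y _ xy _|x y ax xy yb xys|x y ax xs sy yb].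
- by apply: stop_causal.
- apply: (@le_tsep_split _ _ _ _ _ x t y) => // [u v _ uv _|u v xu uv vy uvt|u v xu ut tv vy].
  + by apply: stop_causal.
  + by apply: nu_stop => //; lra.
  + by apply: atom_stop => //; [right|lra..].
- by apply: atom_stop => //; [left|lra..].
Qed.

(* A competitor of [nu] for the curve itself: maximality of [nu] against it bounds
   [nu'] between s and t. *)
Definition spliced_measure (nu nu' : borel_measure) : borel_measure :=
  measure_add (mrestr nu' (measurable_itv `]s, t[))
    (mrestr nu (measurableC (measurable_itv `[s, t]))).

(** Each interval avoiding s and t sees only one of the two measures. The points s and t themselves
    were given no mass, so at the splitting points only causality of the curve is needed. *)
Lemma spliced_measure_below nu nu' : measure_below_tsep l c nu ->
  measure_below_tsep l stop nu' -> measure_below_tsep l c (spliced_measure nu nu').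
Proof.
move=> [nu0 nuP] [nu0' nuP'].
have E A : spliced_measure nu nu' A = nu' (A `&` `]s, t[%classic) + nu (A `&` ~` `[s, t]%classic).
  by rewrite /spliced_measure measure_sumE.
split.
  rewrite E (_ : _ `&` _ = set0) ?measure0 ?add0e; last first.
    by rewrite -subset0 => r [] /=; rewrite !in_itv /= => h1 h2; apply: h1; move: s0 t1; lra.
  apply/eqP; rewrite eq_le measure_ge0 andbT -nu0.
  apply: le_measure; rewrite ?inE; [|exact: measurableC|exact: subIsetl].
  by apply: measurableI; exact: measurableC.
clear nu0 nu0'; move=> a b a0 ab b1.
have gap (x y : R) : (0 <= x)%R -> (x < y)%R -> (y <= 1)%R ->
    (y <= s)%R \/ (s <= x)%R -> (y <= t)%R \/ (t <= x)%R ->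
    spliced_measure nu nu' `]x, y[%classic <= l (c x) (c y).
  move=> x0 xy y1 xys xyt; rewrite E.
  have [xst|xst] : ((s <= x)%R /\ (y <= t)%R) \/ ((y <= s)%R \/ (t <= x)%R) by lra.
    rewrite [X in nu X](_ : _ = set0) ?measure0 ?adde0; last first.
      by rewrite -subset0 => r [] /=; rewrite !in_itv /= => h1 h2; apply: h2; lra.
    have := nuP' x y x0 xy y1; rewrite /stop /= !stop_time_id; [|lra..].
    apply: le_trans; apply: le_measure; rewrite ?inE; [|exact: measurable_itv|exact: subIsetl].
    by apply: measurableI.
  rewrite [X in nu' X](_ : _ = set0) ?measure0 ?add0e; last first.
    by rewrite -subset0 => r [] /=; rewrite !in_itv /= => h1 h2; lra.
  apply: le_trans (nuP x y x0 xy y1).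
  apply: le_measure; rewrite ?inE; [|exact: measurable_itv|exact: subIsetl].
  by apply: measurableI => //; exact: measurableC.
have atom0 (z x y : R) : z = s \/ z = t -> (0 <= x)%R -> (x < z)%R -> (z < y)%R -> (y <= 1)%R ->
    spliced_measure nu nu' [set z] <= l (c x) (c y).
  move=> zst x0 xz zy y1; rewrite E.
  rewrite [X in nu' X](_ : _ = set0); last first.
    by rewrite -subset0 => r [/= ->]; rewrite in_itv /=; move: st zst; lra.
  rewrite [X in nu X](_ : _ = set0); last first.
    by rewrite -subset0 => r [/= ->]; rewrite in_itv /=; move: st zst; lra.
  by rewrite !measure0 adde0; apply: cc; lra.
apply: (@le_tsep_split _ _ _ _ _ a s b) => // [x y ? ? ?|x y ax xy yb xys|x y ax xs sy yb].
- by apply: cc; lra.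
- apply: (@le_tsep_split _ _ _ _ _ x t y) => // [u v ? ? ?|u v xu uv vy uvt|u v xu ut tv vy].
  + by apply: cc; lra.
  + by apply: gap => //; lra.
  + by apply: atom0 => //; [right|lra..].
- by apply: atom0 => //; [left|lra..].
Qed.

End stopped_curve.

Section speed_of_stopped_curve.
Context (R : realType) (M : ptopologicalType) (l : time_separation R M).
Context (c : R -> M) (s t : R).
Hypotheses (s0 : (0 <= s)%R) (st : (s < t)%R) (t1 : (t <= 1)%R).
Hypothesis cc : forall r r', (0 <= r)%R -> (r <= r')%R -> (r' <= 1)%R ->
  causal_le l (c r) (c r').
Notation borel_measure := {measure set (measurableTypeR R) -> \bar R}.
Local Notation leb := (@lebesgue_measure R).
Local Notation F := ([set 0%R; s; t; 1%R] : set (measurableTypeR R)).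

Let mF : measurable F. Proof. by do 3 apply: measurableU => //. Qed.

Let mst : measurable (`]s, t[%classic : set (measurableTypeR R)).
Proof. exact: measurable_itv. Qed.

Let lebF : leb F = 0.
Proof.
apply: countable_lebesgue_measure0; apply: finite_set_countable.
by do 3 (rewrite finite_setU; split => //).
Qed.

Let Fst : F `&` `]s, t[%classic = set0.
Proof.
rewrite -subset0 => r [] /=; rewrite in_itv /= => h1 h2.
by move: s0 t1; case: h1 => [[[]|]|] e; lra.
Qed.

Let itv_cases r : (0 <= r <= 1)%R ->
  [\/ (s < r < t)%R, (0 < r < s)%R, (t < r < 1)%R | F r].
Proof.
move: s0 st t1 => s0' st' t1' r01.
have [?|?|?] := ltgtP r 0%R; first by exfalso; lra.
  have [?|?|?] := ltgtP r s; first by constructor 2; lra.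
    have [?|?|?] := ltgtP r t; first by constructor 1; lra.
      have [?|?|?] := ltgtP r 1%R; first by constructor 3; lra.
        by exfalso; lra.
      by constructor 4; right.
    by constructor 4; left; right.
  by constructor 4; left; left; right.
by constructor 4; left; left; left.
Qed.

Lemma stopped_measure_offF (nu : borel_measure) A : measurable A -> A `&` F = set0 ->
  stopped_measure l c s t nu A = nu (A `&` `]s, t[%classic).
Proof.
move=> mA AF; have h r : F r -> ~ A r.
  by move=> Fr Ar; have : (A `&` F) r by []; rewrite AF.
by rewrite stopped_measure_notin //; apply: h => /=; tauto.
Qed.

(** A competitor [nu'] is bounded on []s, t[] by splicing it into [nu] and using the maximality of
    [nu]. It vanishes on []0, s[] and []t, 1[], where the stopped curve is constant and [l] is zero,
    and off [[0, 1]]. Its masses at the four remaining points are below [largest_atom] by definition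
    of the supremum. *)
Lemma stopped_measure_largest (nu : borel_measure) :
  largest_measure (measure_below_tsep l c) nu ->
  largest_measure (measure_below_tsep l (stop c s t)) (stopped_measure l c s t nu).
Proof.
move=> [nuP numax]; split; first exact: stopped_measure_below.
move=> nu' nu'P A mA.
have := numax _ (spliced_measure_below s0 st t1 cc nuP nu'P) (A `&` `]s, t[%classic).
rewrite /spliced_measure /= => /(_ (measurableI _ _ mA mst)).
rewrite (_ : (measure_add _ _ : borel_measure) _ = nu' (A `&` `]s, t[%classic)); last first.
  rewrite [LHS]measure_addE /= /mrestr -setIA setIid -setIA.
  rewrite [X in nu X](_ : _ = set0) ?measure0 ?adde0 //.
  by rewrite -subset0 => r [_ []] /=; rewrite !in_itv /= => h1 h2; apply: h2; lra.
move=> nu'st.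
have Z (B : set (measurableTypeR R)) : measurable B -> nu' B = 0 -> nu' (A `&` B) = 0.
  by move=> mB; apply: (measure0_subset (measurableI _ _ mA mB) mB (@subIsetr _ _ _)).
have out0 (x y : R) : (0 <= x)%R -> (x <= y)%R -> (y <= 1)%R -> (y <= s)%R \/ (t <= x)%R ->
    nu' `]x, y[%classic = 0.
  move=> x0; rewrite le_eqVlt => /predU1P[<- _ _|xy y1 h]; first by rewrite set_itvoo0 // measure0.
  apply/eqP; rewrite eq_le measure_ge0 andbT (le_trans (nu'P.2 x y x0 xy y1)) //.
  rewrite /stop /=; case: h => h.
    by rewrite !stop_time_le ?tsep_refl //; lra.
  by rewrite !stop_time_ge ?tsep_refl //; lra.
have sub : A `<=` A `&` `]s, t[%classic `|` (A `&` `]0%R, s[%classic `|` A `&` `]t, 1%R[%classic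
    `|` A `&` ~` `[0%R, 1%R]%classic `|` A `&` F).
  move=> r Ar; have [r01|r01] := boolP (0 <= r <= 1)%R; last first.
    by right; left; right; split=> //=; rewrite in_itv /=; exact/negP.
  case: (itv_cases r01) => h.
  - by left; split=> //=; rewrite in_itv.
  - by right; left; left; left; split=> //=; rewrite in_itv.
  - by right; left; left; right; split=> //=; rewrite in_itv.
  - by right; right.
have m1 := measurableI _ _ mA mst.
have m2 : measurable (A `&` `]0%R, s[%classic) by exact: measurableI.
have m3 : measurable (A `&` `]t, 1%R[%classic) by exact: measurableI.
have m4 : measurable (A `&` ~` `[0%R, 1%R]%classic) by apply: measurableI => //; exact: measurableC.
have m5 : measurable (A `&` F) by exact: measurableI.
have m24 := measurableU _ _ (measurableU _ _ m2 m3) m4.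
apply: (@le_trans _ _ (nu' (A `&` `]s, t[%classic `|` (A `&` `]0%R, s[%classic `|` A `&` `]t, 1%R[%classic
    `|` A `&` ~` `[0%R, 1%R]%classic `|` A `&` F)))).
  by apply: le_measure => //; rewrite inE //; do 2 apply: measurableU => //.
rewrite (le_trans (measure_setU_le _ _ _)) //; first by apply: measurableU.
rewrite stopped_measureE leeD //.
rewrite (le_trans (measure_setU_le _ _ _)) //.
rewrite (le_trans (leeD (measure_setU_le _ _ _) (lexx _))) //; first by apply: measurableU.
rewrite (le_trans (leeD (leeD (measure_setU_le _ _ _) (lexx _)) (lexx _))) //.
rewrite (Z _ (measurable_itv _)) ?add0e; last by apply: out0 => //; [exact: le_trans (ltW st) t1|left].
rewrite (Z _ (measurable_itv _)) ?add0e; last by apply: out0 => //; [exact: le_trans (ltW st)|right].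
rewrite (Z _ (measurableC (measurable_itv _))) ?add0e; last exact: nu'P.1.
have at1 (x : R) : nu' (A `&` [set x]) <= atom x (largest_atom l c s t x) A.
  have [Ax|Ax] := pselect (A x); last first.
    rewrite [X in nu' X](_ : _ = set0) ?measure0 ?atom_notin //.
    by rewrite -subset0 => r [Ar /= rx]; apply: Ax; rewrite -rx.
  rewrite atom_in //; last by rewrite /largest_atom le_max lexx.
  rewrite /largest_atom le_max; apply/orP; right.
  apply: ereal_sup_ubound; exists nu' => //; congr (nu' _).
  by apply/seteqP; split=> [r /= ->|r []].
rewrite !setIUr.
have mx (x : R) : measurable (A `&` [set x]) by exact: measurableI.
have mxy (x y : R) : measurable (A `&` [set x] `|` A `&` [set y]) by exact: measurableU.
rewrite (le_trans (measure_setU_le _ _ _)) //; first by apply: measurableU.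
rewrite (le_trans (leeD (measure_setU_le _ _ _) (lexx _))) //.
rewrite (le_trans (leeD (leeD (measure_setU_le _ _ _) (lexx _)) (lexx _))) //.
by rewrite -addeA; do 3 apply: leeD => //.
Qed.

(** The four possible atoms lie in a Lebesgue-null set, so an absolutely continuous competitor [mu']
    ignores them, and it vanishes elsewhere off []s, t[] because the stopped measure does.
    Restricted to []s, t[], it competes with [mu] below [nu]. *)
Lemma stopped_ac_part (nu mu : borel_measure) : ac_part nu mu ->
  ac_part (stopped_measure l c s t nu) (mrestr mu mst : borel_measure).
Proof.
move=> [[mu_nu mu_ac] mumax]; split; first split.
- move=> A mA; rewrite stopped_measureE (le_trans (mu_nu _ (measurableI _ _ mA mst))) //.
  by rewrite leeDl // !adde_ge0.
- move=> A mA A0; apply: mu_ac; first exact: measurableI.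
  exact: (measure0_subset (measurableI _ _ mA mst) mA (@subIsetl _ _ _) A0).
move=> mu' [mu'_nu mu'_ac] A mA.
have mFC := measurableC mF.
have mstC := measurableC mst.
have mu'F : mu' (A `&` F) = 0.
  apply: mu'_ac; first exact: measurableI.
  exact: (measure0_subset (measurableI _ _ mA mF) mF (@subIsetr _ _ _) lebF).
have m1 : measurable (A `&` `]s, t[%classic) by exact: measurableI.
have m2 : measurable (A `&` (~` `]s, t[%classic `&` ~` F)).
  by apply: measurableI => //; exact: measurableI.
have m3 : measurable (A `&` F) by exact: measurableI.
have mu'out : mu' (A `&` (~` `]s, t[%classic `&` ~` F)) = 0.
  apply/eqP; rewrite eq_le measure_ge0 andbT (le_trans (mu'_nu _ m2)) //.
  rewrite stopped_measure_offF //; last by rewrite -subset0 => r [[_ [_ h]]].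
  by rewrite [X in nu X](_ : _ = set0) ?measure0 // -subset0 => r [[_ [h _]]].
apply: (@le_trans _ _ (mu' (A `&` `]s, t[%classic `|` (A `&` (~` `]s, t[%classic `&` ~` F) `|` A `&` F)))).
  apply: le_measure; rewrite ?inE //; first by do 2 apply: measurableU => //.
  move=> r Ar; have [h|h] := pselect (`]s, t[%classic r); first by left.
  by right; have [h'|h'] := pselect (F r); [right|left].
rewrite (le_trans (measure_setU_le _ _ _)) //; first by apply: measurableU.
apply: (le_trans (leeD (lexx _) (measure_setU_le _ _ _))) => //.
rewrite mu'F mu'out !adde0.
have := mumax (mrestr mu' mst : borel_measure) _ _ m1.
rewrite /= /mrestr -setIA setIid; apply; split => [B mB|B mB B0].
  have mB1 : measurable (B `&` `]s, t[%classic) by exact: measurableI.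
  rewrite (le_trans (mu'_nu _ mB1)) // stopped_measure_offF //; last first.
    by rewrite -setIA (setIC _ F) Fst setI0.
  by rewrite -setIA setIid; apply: measure_subset => //; exact: subIsetl.
apply: mu'_ac; first exact: measurableI.
exact: (measure0_subset (measurableI _ _ mB mst) mB (@subIsetl _ _ _) B0).
Qed.

Lemma stopped_causal_speed v : is_causal_speed l c v ->
  is_causal_speed l (stop c s t) (v \_ `]s, t[%classic).
Proof.
move=> [nu [mu [nuP muP mv v0 muE]]].
exists (stopped_measure l c s t nu), (mrestr mu mst : borel_measure); split.
- exact: stopped_measure_largest.
- exact: stopped_ac_part.
- apply/(measurable_restrictT v (measurable_itv `]s, t[)); exact: measurable_funTS.
- by move=> r; rewrite /patch; case: ifP.
move=> A mA; rewrite /= /mrestr muE; last exact: measurableI.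
rewrite -integral_mkcondr; congr (integral _ _ _).
by rewrite setIAC.
Qed.
End speed_of_stopped_curve.

Section speed_uniqueness.
Context (R : realType) (M : ptopologicalType) (l : time_separation R M).
Local Notation leb := (@lebesgue_measure R).

Lemma causal_speed_unique (c : R -> M) v w : is_causal_speed l c v ->
  is_causal_speed l c w -> forall A : set (measurableTypeR R), measurable A ->
  \int[leb]_(t in A `&` `[0%R, 1%R]) v t = \int[leb]_(t in A `&` `[0%R, 1%R]) w t.
Proof.
move=> [nu [mu [nuP muP _ _ muE]]] [nu' [mu' [nuP' muP' _ _ muE']]] A mA.
rewrite -muE // -muE' //.
have nuE B : measurable B -> nu B = nu' B.
  by move=> mB; apply/eqP; rewrite eq_le nuP.2 //; [rewrite nuP'.2 //; exact: nuP.1|exact: nuP'.1].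
case: muP muP' => [[h1 h2] h3] [[h1' h2'] h3'].
apply/eqP; rewrite eq_le; apply/andP; split.
  by apply: h3' => //; split=> // B mB; rewrite -nuE // h1.
by apply: h3 => //; split=> // B mB; rewrite nuE // h1'.
Qed.

End speed_uniqueness.

Section causal_speed_of_stop.
Context (R : realType) (M : ptopologicalType) (l : time_separation R M).
Local Notation leb := (@lebesgue_measure R).

(** Existence of a speed is not presupposed: if there is none, the default value 0 makes the
    integral to be bounded vanish. *)
Lemma causal_speedP (c : R -> M) : is_causal_speed l c (causal_speed l c) \/
  ((forall v, ~ is_causal_speed l c v) /\ causal_speed l c = cst 0).
Proof.
have [[v vP]|nv] := pselect (exists v, is_causal_speed l c v).
  by left; rewrite /causal_speed; apply: (xgetPex (cst 0) (ex_intro _ v vP)).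
right; have h v : ~ is_causal_speed l c v by move=> vP; apply: nv; exists v.
by split => //; rewrite /causal_speed xgetPN.
Qed.

Lemma causal_speed_ge0 (c : R -> M) r : 0 <= causal_speed l c r.
Proof. by have [[nu [mu []]]|[_ ->]] := causal_speedP c. Qed.

Lemma measurable_causal_speed (c : R -> M) : measurable_fun setT (causal_speed l c).
Proof.
have [[nu [mu []]]|[_ ->]] // := causal_speedP c.
Qed.

(** By uniqueness of the largest measures, the chosen speed of the stopped curve has the same
    integrals over Borel sets as the speed of [c] cut off outside []s, t[], hence dominates the
    latter a.e. This direction is the one that transfers an upper bound from the stopped curve to
    the slab []s, t[]. *)
Lemma causal_speed_stop (c : R -> M) (s t : R) (w : R -> \bar R) :
  (0 <= s)%R -> (s < t)%R -> (t <= 1)%R ->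
  (forall r r', (0 <= r)%R -> (r <= r')%R -> (r' <= 1)%R -> causal_le l (c r) (c r')) ->
  measurable_fun setT w -> (forall r, 0 <= w r) ->
  \int[leb]_(r in `]s, t[) (w r * causal_speed l c r) <=
  \int[leb]_(r in `[0%R, 1%R]) (w r * causal_speed l (stop c s t) r).
Proof.
move=> s0 st t1 cc mw w0.
have m01 : measurable (`[0%R, 1%R]%classic : set (measurableTypeR R)) by exact: measurable_itv.
have mst : measurable (`]s, t[%classic : set (measurableTypeR R)) by exact: measurable_itv.
have [vP|[_ ->]] := causal_speedP c; last first.
  under eq_integral do rewrite mule0.
  by rewrite integral0 integral_ge0 // => r _; rewrite mule_ge0 // causal_speed_ge0.
have vP' := stopped_causal_speed s0 st t1 cc vP.
have [v2P|[nv _]] := causal_speedP (stop c s t); last by case: (nv _ vP').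
have l01 : leb `[0%R, 1%R]%classic < +oo.
  by rewrite lebesgue_measure_itv /= lte_fin ltr01 oppr0 adde0 ltry.
have mv := measurable_causal_speed c.
have mv' : measurable_fun setT (causal_speed l c \_ `]s, t[%classic).
  by apply/(measurable_restrictT _ (measurable_itv `]s, t[)); exact: measurable_funTS.
have mv2 := measurable_causal_speed (stop c s t).
have v'0 r : 0 <= (causal_speed l c \_ `]s, t[%classic) r.
  by rewrite /patch; case: ifP => // _; exact: causal_speed_ge0.
have le_ae : {ae leb, forall r, `[0%R, 1%R]%classic r ->
    (causal_speed l c \_ `]s, t[%classic) r <= causal_speed l (stop c s t) r}.
  apply: (@ae_le_integral_subset _ (measurableTypeR R) R leb) => //.
  - by move=> r; exact: causal_speed_ge0.
  - by move=> A mA; rewrite (causal_speed_unique vP' v2P mA).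
rewrite (_ : \int[leb]_(r in `]s, t[) _ =
  \int[leb]_(r in `[0%R, 1%R]) (w r * (causal_speed l c \_ `]s, t[%classic) r)).
  apply: ae_ge0_le_integral => //.
  - by move=> r _; rewrite mule_ge0.
  - by apply: measurable_funTS; exact: emeasurable_funM.
  - by move=> r _; rewrite mule_ge0 // causal_speed_ge0.
  - by apply: measurable_funTS; exact: emeasurable_funM.
  - case: le_ae => N [mN N0 hN]; exists N; split => // r hr; apply: hN => /= h; apply: hr => /= r01.
    by rewrite lee_wpmul2l // h.
have -> : \int[leb]_(r in `]s, t[) (w r * causal_speed l c r) =
    \int[leb]_(r in `[0%R, 1%R]%classic `&` `]s, t[%classic) (w r * causal_speed l c r).
  congr (integral _ _ _); rewrite setIidr // => r /=; rewrite !in_itv /= => /andP[h1 h2].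
  by rewrite (le_trans s0 (ltW h1)) (le_trans (ltW h2) t1).
rewrite integral_mkcondr; apply: eq_integral => r _ /=.
by rewrite /patch; case: ifP => // _; exact/esym/mule0.
Qed.

End causal_speed_of_stop.

(** * The Leibniz inequality along a curve *)

Section ereal_sequences.
Context (R : realType).
Implicit Types (x v : \bar R) (a : nat -> \bar R).

(** Thresholds are rational so that, for a monotone function evaluated along the grid, the failure
    of the hypothesis is a countable union of small sets. The limit may be [+oo]. *)
Lemma cvg_from_below a x : (forall n, 0 <= a n <= x) ->
  (forall q : rat, (ratr q)%:E < x -> \forall n \near \oo, (ratr q)%:E < a n) ->
  a n @[n --> \oo] --> x.
Proof.
case: x => [r| |] ax aq; last by have /andP[h1 h2] := ax 0%N; have := le_trans h1 h2.
  have af n : a n \is a fin_num.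
    by have /andP[a0 ar] := ax n; rewrite ge0_fin_numE // (le_lt_trans ar) // ltry.
  rewrite (_ : a = EFin \o (fine \o a)); last by apply/funext => n /=; rewrite fineK.
  apply: cvg_EFin; first by near=> n.
  rewrite (_ : fine \o _ = fine \o a) //.
  apply/cvgrPdist_lt => e e0.
  have re : (r - e < r)%R by rewrite ltrBlDr ltrDl.
  have [q] := rat_in_itvoo re.
  rewrite in_itv /= => /andP[qe qr]; have := aq q; rewrite lte_fin => /(_ qr).
  apply: filterS => n; have /andP[_] := ax n; rewrite -(fineK (af n)) lee_fin lte_fin => ar qa.
  by rewrite /= ger0_norm ?subr_ge0 // ltrBlDr -ltrBlDl (lt_trans qe).
apply/cvgeyPge => A.
have A1 : (A < A + 1)%R by rewrite ltrDl.
have [q] := rat_in_itvoo A1.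
rewrite in_itv /= => /andP[Aq _].
by have := aq q (ltry _); apply: filterS => n /ltW; apply: le_trans; rewrite lee_fin ltW.
Unshelve. all: by end_near. Qed.

(** The product is discontinuous at 0 times [+oo], but convergence from below avoids the problem:
    for [v = +oo], either x = 0 and every [a n] is 0, or x > 0 and eventually [a n > 0], so that the
    products equal [+oo]. *)
Lemma cvg_muler_below a x v : 0 <= v -> (forall n, 0 <= a n <= x) ->
  (forall q : rat, (ratr q)%:E < x -> \forall n \near \oo, (ratr q)%:E < a n) ->
  a n * v @[n --> \oo] --> x * v.
Proof.
case: v => [v| |] // v0 ax aq; first by apply: cvgeZr => //; exact: cvg_from_below.
have x0 : 0 <= x by have /andP[h1 h2] := ax 0%N; exact: le_trans h2.
move: x0; rewrite le_eqVlt => /predU1P[x0|x0].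
  apply: cvg_near_cst; near=> n; congr (_ * _).
  by apply/eqP; rewrite eq_le (andP (ax n)).2 -x0 (andP (ax n)).1.
apply: cvg_near_cst.
have [p [q [pq p0 qx]]] := ereal_rat_between (lexx 0) x0.
have := aq q qx; apply: filterS => n an; rewrite !gt0_muley //.
by apply: lt_trans an; apply: lt_trans p0 _; rewrite lte_fin ltr_rat.
Unshelve. all: by end_near. Qed.

(* One factor may be infinite if the other one vanishes. *)
Lemma leibniz_esub (x x' y y' : \bar R) : 0 <= x <= x' -> 0 <= y <= y' ->
  x' * y' < +oo ->
  x * esub y' y + y * esub x' x <= esub (x' * y') (x * y).
Proof.
move=> /andP[x0 xx] /andP[y0 yy] xyoo.
have [x'0|x'0] := eqVneq x' 0.
  have -> : x = 0 by apply/eqP; rewrite eq_le x0 -x'0 xx.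
  by rewrite x'0 !mul0e /esub sube0 mule0 adde0.
have [y'0|y'0] := eqVneq y' 0.
  have -> : y = 0 by apply/eqP; rewrite eq_le y0 -y'0 yy.
  by rewrite y'0 !mule0 mul0e /esub sube0 mule0 adde0.
have x'0' : 0 < x' by rewrite lt0e x'0 (le_trans x0 xx).
have y'0' : 0 < y' by rewrite lt0e y'0 (le_trans y0 yy).
case: x' xx xyoo x'0' {x'0} => [x'| |] // xx xyoo x'0; last by move: xyoo; rewrite gt0_mulye.
case: y' yy xyoo y'0' {y'0} => [y'| |] // yy xyoo y'0; last by move: xyoo; rewrite gt0_muley.
case: x x0 xx => [x| |] // x0 xx; case: y y0 yy => [y| |] // y0 yy.
rewrite !lee_fin in x0 xx y0 yy.
(* The right side minus the left side is (x' - x)(y' - y). *)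
rewrite /esub -?EFinM -?EFinN -?EFinD -?EFinM -?EFinD lee_fin; nra.
Qed.

End ereal_sequences.

(** * Riemann-type sums for a product of monotone functions *)

Section leibniz_along_curve.
Context (R : realType) (F G u v : R -> \bar R).
Local Notation leb := (@lebesgue_measure R).
Local Notation tk n k := (k%:R / n.+1%:R : R)%R.

Hypotheses (F0 : forall r, 0 <= F r) (G0 : forall r, 0 <= G r).
Hypotheses (F_homo : {homo F : r r' / (r <= r')%R >-> r <= r'})
  (G_homo : {homo G : r r' / (r <= r')%R >-> r <= r'}).
Hypotheses (u0 : forall r, 0 <= u r) (v0 : forall r, 0 <= v r).
Hypotheses (mu_ : measurable_fun setT (u : measurableTypeR R -> \bar R))
  (mv_ : measurable_fun setT (v : measurableTypeR R -> \bar R)).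
Hypothesis uF : forall n k, (k < n.+1)%N ->
  \int[leb]_(r in `](tk n k), (tk n k.+1)[) u r <= esub (F (tk n k.+1)) (F (tk n k)).
Hypothesis vG : forall n k, (k < n.+1)%N ->
  \int[leb]_(r in `](tk n k), (tk n k.+1)[) v r <= esub (G (tk n k.+1)) (G (tk n k)).

Let K n r := F (grid n r) * v r + G (grid n r) * u r.

Let mK n : measurable_fun setT (K n : measurableTypeR R -> \bar R).
Proof.
apply: emeasurable_funD; apply: emeasurable_funM => //.
  exact: (@measurable_fun_grid_index R _ _ n (fun k => F (k%:~R / n.+1%:R)%R)).
exact: (@measurable_fun_grid_index R _ _ n (fun k => G (k%:~R / n.+1%:R)%R)).
Qed.

Let K0 n r : 0 <= K n r. Proof. by rewrite adde_ge0 // mule_ge0. Qed.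

Let tk_le n k k' : (k <= k')%N -> (tk n k <= tk n k')%R.
Proof. by move=> kk; rewrite ler_wpM2r ?ler_nat. Qed.

(** On the cell the last grid point strictly before r is its left end, so [F] and [G] leave the
    integral as constants. Passing from the open cell of the hypotheses to the half-open one adds a
    null point. *)
Let int_cell n k : (k < n.+1)%N ->
  \int[leb]_(r in `](tk n k), (tk n k.+1)]) K n r <=
    F (tk n k) * esub (G (tk n k.+1)) (G (tk n k)) +
    G (tk n k) * esub (F (tk n k.+1)) (F (tk n k)).
Proof.
move=> kn.
have mI : measurable (`](tk n k), (tk n k.+1)]%classic : set (measurableTypeR R)).
  exact: measurable_itv.
rewrite (_ : \int[leb]_(r in _) _ = \int[leb]_(r in `](tk n k), (tk n k.+1)])
    (F (tk n k) * v r + G (tk n k) * u r)); last first.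
  by apply: eq_integral => r; rewrite inE /= => /grid_itvP rk; rewrite /K rk.
have mu1 D : measurable_fun D (u : measurableTypeR R -> \bar R) by exact: measurable_funTS.
have mv1 D : measurable_fun D (v : measurableTypeR R -> \bar R) by exact: measurable_funTS.
rewrite ge0_integralD //; last 4 first.
- by move=> r _; rewrite mule_ge0.
- by apply: emeasurable_funM => //; exact: measurable_cst.
- by move=> r _; rewrite mule_ge0.
- by apply: emeasurable_funM => //; exact: measurable_cst.
rewrite !ge0_integralZl //.
have hu : \int[leb]_(r in `](tk n k), (tk n k.+1)]) u r <= esub (F (tk n k.+1)) (F (tk n k)).
  by rewrite -integral_itv_bndo_bndc; [exact: uF|exact: mu1].
have hv : \int[leb]_(r in `](tk n k), (tk n k.+1)]) v r <= esub (G (tk n k.+1)) (G (tk n k)).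
  by rewrite -integral_itv_bndo_bndc; [exact: vG|exact: mv1].
by apply: leeD; apply: lee_wpmul2l.
Qed.

(** Monotonicity and [F 1 * G 1 < +oo] make the products at all grid points finite, even if one
    factor is infinite. There [esub] is ordinary subtraction, and the cell bounds telescope by
    induction on k. *)
Lemma int_grid_le n k : F 1%R * G 1%R < +oo -> (k <= n.+1)%N ->
  \int[leb]_(r in `]0%R, (tk n k)]) K n r <= esub (F (tk n k) * G (tk n k)) (F 0%R * G 0%R).
Proof.
move=> FG1.
have FGle r r' : (r <= r')%R -> F r * G r <= F r' * G r'.
  by move=> rr; apply: lee_pmul => //; [exact: F_homo|exact: G_homo].
have fin k' : (k' <= n.+1)%N -> F (tk n k') * G (tk n k') \is a fin_num.
  move=> kn; rewrite ge0_fin_numE ?mule_ge0 // (le_lt_trans _ FG1) // FGle //.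
  by rewrite ler_pdivrMr // mul1r ler_nat.
have subE k' : (k' <= n.+1)%N -> forall k'', (k'' <= n.+1)%N ->
    esub (F (tk n k') * G (tk n k')) (F (tk n k'') * G (tk n k'')) =
    F (tk n k') * G (tk n k') - F (tk n k'') * G (tk n k'').
  by move=> h1 k'' h2; rewrite -(fineK (fin _ h1)) -(fineK (fin _ h2)).
have tk0 : tk n 0%N = 0%R by rewrite mul0r.
rewrite (_ : F 0%R * G 0%R = F (tk n 0%N) * G (tk n 0%N)); last by rewrite tk0.
elim: k => [|k IH] kn.
  by rewrite tk0 set_itvoc0 integral_set0 -tk0 subE // subee // fin.
have m1 : measurable (`]0%R, (tk n k)]%classic : set (measurableTypeR R)) by exact: measurable_itv.
have m2 : measurable (`](tk n k), (tk n k.+1)]%classic : set (measurableTypeR R)) by exact: measurable_itv.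
have -> : `]0%R, (tk n k.+1)]%classic = `]0%R, (tk n k)]%classic `|` `](tk n k), (tk n k.+1)]%classic.
  rewrite (@itv_bndbnd_setU _ _ _ (BRight (tk n k))) // bnd_simp ?divr_ge0 //.
  exact: tk_le.
rewrite ge0_integral_setU //; last 2 first.
- exact: measurable_funTS.
- apply/disj_setPS => r [] /=; rewrite !in_itv /= => /andP[_ h1] /andP[h2 _].
  by move: h2; rewrite ltNge h1.
apply: (le_trans (leeD (IH (ltnW kn)) (int_cell kn))).
apply: (le_trans (leeD (lexx _) (leibniz_esub _ _ _))).
- by rewrite F0 F_homo // tk_le.
- by rewrite G0 G_homo // tk_le.
- by have := fin _ kn; rewrite ge0_fin_numE // mule_ge0.
rewrite !subE // ?(ltnW kn) //.
move: (fin _ kn) (fin _ (ltnW kn)) (fin _ (leq0n n.+1)).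
move: (F (tk n k.+1) * _) (F (tk n k) * _) (F (tk n 0) * _) => [x| |] // [y| |] // [z| |] // _ _ _.
by rewrite -!EFinN -!EFinD lee_fin; lra.
Qed.

(** Convergence can fail for a threshold q only at an r where [f] jumps above q exactly at r, having
    stayed at most q before. By monotonicity there is at most one such r for each q, hence countably
    many in all. *)
Let cvg_grid_homo (f : R -> \bar R) : {homo f : r r' / (r <= r')%R >-> r <= r'} ->
  {ae leb, forall r, forall q : rat, (ratr q)%:E < f r ->
     \forall n \near \oo, (ratr q)%:E < f (grid n r)}.
Proof.
move=> f_homo.
pose bad (q : rat) := [set r | (ratr q)%:E < f r /\ forall s, (s < r)%R -> f s <= (ratr q)%:E].
have bad1 q : is_subset1 (bad q).
  move=> r r' [h1 h2] [h1' h2']; have [rr|rr|//] := ltgtP r r'.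
    by have := h2' _ rr; rewrite leNgt h1.
  by have := h2 _ rr; rewrite leNgt h1'.
have bad01 q : bad q = set0 \/ exists r, bad q = [set r].
  have [[r br]|nb] := pselect (exists r, bad q r); last first.
    by left; rewrite -subset0 => r br; apply: nb; exists r.
  by right; exists r; apply/seteqP; split=> [r' /(bad1 q _ _ br)|r' ->].
exists (\bigcup_q bad q); split.
- apply: countable_bigcupT_measurable => [|q]; first exact: countableP.
  by have [->|[r ->]] := bad01 q.
- apply: countable_lebesgue_measure0; apply: bigcup_countable => [|q _]; first exact: countableP.
  by have [->|[r ->]] := bad01 q.
move=> r /= /existsNP[q] /not_implyP[qf nq]; exists q => //; split=> // s sr.
rewrite leNgt; apply/negP => qs; apply: nq.
have : \forall n \near \oo, (s < grid n r)%R.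
  exact: (@cvg_grid R r _ (nbhs_left_gt sr)).
by apply: filterS => n /ltW /f_homo; exact: lt_le_trans.
Qed.

Lemma leibniz_curve (H : R -> \bar R) :
  measurable_fun setT (H : measurableTypeR R -> \bar R) -> (forall r, 0 <= H r) ->
  {ae leb, forall r, `[0%R, 1%R]%classic r -> H r <= F r * v r + G r * u r} ->
  \int[leb]_(r in `[0%R, 1%R]) H r <= esub (F 1%R * G 1%R) (F 0%R * G 0%R).
Proof.
move=> mH H0 HFG.
(* If the final product is infinite, the convention that [+oo] minus [+oo] is [+oo] makes the right
   side infinite whatever the initial product. *)
have [FG1|] := ltP (F 1%R * G 1%R) +oo; last first.
  rewrite leye_eq => /eqP ->; rewrite (_ : esub _ _ = +oo) ?leey //.
  by have : 0 <= F 0%R * G 0%R by [rewrite mule_ge0]; case: (F 0%R * G 0%R).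
have mI : measurable (`]0%R, 1%R]%classic : set (measurableTypeR R)) by exact: measurable_itv.
have mlim : measurable_fun setT (fun r : measurableTypeR R => limn_einf (K ^~ r)).
  apply: (emeasurable_fun_cvg (fun n (r : measurableTypeR R) => einfs (K ^~ r) n)).
    by move=> n; apply: measurable_fun_einfs.
  by move=> r _; rewrite limn_einf_lim; exact: is_cvg_einfs.
have lim0 r : 0 <= limn_einf (K ^~ r).
  rewrite limn_einf_lim; apply: lime_ge; first exact: is_cvg_einfs.
  by near=> n; apply: le_ereal_inf_tmp => _ [k _ <-].
rewrite -integral_itv_obnd_cbnd; last exact: measurable_funTS.
apply: (@le_trans _ _ (\int[leb]_(r in `]0%R, 1%R]) limn_einf (K ^~ r))).
  apply: ae_ge0_le_integral => //; [exact: measurable_funTS|exact: measurable_funTS|].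
  move: HFG (cvg_grid_homo F_homo) (cvg_grid_homo G_homo).
  move=> [N1 [m1 n1 h1]] [N2 [m2 n2 h2]] [N3 [m3 n3 h3]].
  exists (N1 `|` N2 `|` N3); split.
  - by do 2 apply: measurableU => //.
  - by rewrite !null_set_setU //; exact: measurableU.
  move=> r /= nr; apply: contrapT => nN; apply: nr => r01.
  have Hr : `[0%R, 1%R]%classic r -> H r <= F r * v r + G r * u r.
    by apply: contrapT => h; apply: nN; left; left; exact: h1.
  have Fr : forall q : rat, (ratr q)%:E < F r -> \forall n \near \oo, (ratr q)%:E < F (grid n r).
    by apply: contrapT => h; apply: nN; left; right; exact: h2.
  have Gr : forall q : rat, (ratr q)%:E < G r -> \forall n \near \oo, (ratr q)%:E < G (grid n r).
    by apply: contrapT => h; apply: nN; right; exact: h3.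
  have /andP[r0 r1] : (0 < r <= 1)%R by move: r01; rewrite /= in_itv.
  apply: (le_trans (Hr _)); first by rewrite /= in_itv /= r1 ltW.
  have grid_le n : (grid n r <= r)%R by have /andP[/ltW] := grid_itv n r.
  have KFG : K n r @[n --> \oo] --> F r * v r + G r * u r.
    apply: cvgeD; first by rewrite ge0_adde_def // inE mule_ge0.
      by apply: cvg_muler_below => // n; rewrite F0 F_homo.
    by apply: cvg_muler_below => // n; rewrite G0 G_homo.
  by rewrite (cvg_limn_einf_sup KFG).
apply: (@le_trans _ _ (limn_einf (fun n => \int[leb]_(r in `]0%R, 1%R]) K n r))).
  by apply: fatou => // n; exact: measurable_funTS.
rewrite limn_einf_lim; apply: lime_le; first exact: is_cvg_einfs.
near=> n; apply: (@le_trans _ _ (\int[leb]_(r in `]0%R, 1%R]) K n r)).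
  by apply: ereal_inf_lbound; exists n => /=.
have := @int_grid_le n n.+1 FG1 (leqnn _).
by rewrite divff.
Unshelve. all: by end_near. Qed.
End leibniz_along_curve.

(** * Localization along test plans *)

Section probability_facts.
Context dT (T : measurableType dT) (R : realType) (P : probability T R).

Lemma probability_lty (A : set T) : measurable A -> P A < +oo.
Proof. by move=> mA; rewrite (le_lt_trans (probability_le1 P mA)) // ltry. Qed.

(** The integral of a nonnegative function is a supremum over simple functions below it, hence
    monotone without measurability. This matters because increments of an [m]-measurable function
    along curves are only measurable off a null set. *)
Lemma ge0_le_integral_nonmeasurable (f g : T -> \bar R) : (forall x, 0 <= f x) ->
  (forall x, f x <= g x) -> \int[P]_x f x <= \int[P]_x g x.
Proof.
move=> f0 fg; rewrite !ge0_integralTE //; last by move=> x; exact: le_trans (fg x).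
apply: ge_ereal_sup => _ [h hf <-]; apply: ereal_sup_ubound; exists h => // x.
exact: le_trans (fg x).
Qed.

Lemma ge0_integral_le_cst (f : T -> \bar R) (p : R) N : measurable N -> P N = 0 ->
  (forall x, 0 <= f x) -> (0 <= p)%R -> (forall x, ~ N x -> f x <= p%:E) ->
  \int[P]_x f x <= p%:E.
Proof.
move=> mN N0 f0 p0 fp; pose g x : \bar R := p%:E + +oo * (\1_N x)%:E.
have gN x : ~ N x -> g x = p%:E by move=> xN; rewrite /g indicE memNset // mule0 adde0.
have g0 x : 0 <= g x by rewrite adde_ge0 // mule_ge0 // lee_fin indicE.
have mg : measurable_fun setT g.
  apply: emeasurable_funD; first exact: measurable_cst.
  apply: emeasurable_funM; first exact: measurable_cst.
  by apply/measurable_EFinP; exact: measurable_indic.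
apply: (@le_trans _ _ (\int[P]_x g x)).
  apply: ge0_le_integral_nonmeasurable => // x; have [xN|xN] := pselect (N x).
    by rewrite /g indicE mem_set // mule1 addey // leey.
  by rewrite gN // fp.
rewrite (_ : \int[P]_x g x = \int[P]_x p%:E).
  rewrite integral_cst // [X in _ * X](_ : _ = 1) ?mule1 //; exact: probability_setT.
apply: ge0_ae_eq_integral => //.
by exists N; split => // x /= /not_implyP[_ gx]; apply: contrapT => xN; apply: gx; exact: gN.
Qed.

(* [E] need not be measurable; this is an estimate of its outer measure. *)
Lemma negligible_contraction (E B0 : set T) (theta : R) :
  (0 <= theta < 1)%R -> measurable B0 -> E `<=` B0 ->
  (forall B, measurable B -> E `<=` B -> B `<=` B0 -> exists B',
     [/\ measurable B', E `<=` B', B' `<=` B & P B' <= theta%:E * P B]) ->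
  P.-negligible E.
Proof.
move=> /andP[t0 t1] mB0 EB0 step.
(* Iteration starts from [B0], whose probability is at most 1; this gives covers of probability at
   most theta^n. *)
have ex n : exists B, [/\ measurable B, E `<=` B, B `<=` B0 & P B <= (theta ^+ n)%:E].
  elim: n => [|n [B [mB EB BB0 PB]]].
    by exists B0; split => //; rewrite expr0 probability_le1.
  have [B' [mB' EB' B'B PB']] := step B mB EB BB0.
  exists B'; split => //; first exact: subset_trans BB0.
  by rewrite exprS EFinM (le_trans PB') // lee_wpmul2l.
have /choice[B BP] := ex.
exists (\bigcap_n B n); split.
- by apply: bigcap_measurable => // n _; case: (BP n).
- apply/eqP; rewrite eq_le measure_ge0 andbT; apply/lee_addgt0Pr => e e0; rewrite add0e.
  have /cvgrPdist_lt/(_ e e0)[n _ /(_ n (leqnn n))] := @cvg_expr R theta (ltac:(by rewrite ger0_norm)).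
  rewrite /= sub0r normrN ger0_norm ?exprn_ge0 // => tn.
  have [mB _ _ PB] := BP n.
  rewrite (@le_trans _ _ (P (B n))) //; last by rewrite (le_trans PB) // lee_fin ltW.
  apply: measure_subset => //; first by apply: bigcap_measurable => // k _; case: (BP k).
  by move=> x; apply.
- by move=> x Ex n _; case: (BP n) => _ EB _ _; exact: EB.
Qed.

End probability_facts.

Section measurable_off_null.
Context dT (T : measurableType dT) (R : realType) (mu : {measure set T -> \bar R}).

(** For each rational q the set [f > q] is measurable up to a null set; the union of these countably
    many null sets is removed. *)
Lemma completed_measurable_off_null (f : T -> \bar R) :
  (forall B, measurable B -> completed_algebra_gen mu (f @^-1` B)) ->
  exists Z, [/\ measurable Z, mu Z = 0 & measurable_fun (~` Z) f].
Proof.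
move=> mf.
have /choice[A AP] (q : rat) : exists AZ : set T * set T, [/\ measurable AZ.1, measurable AZ.2,
    mu AZ.2 = 0 & forall x, ~ AZ.2 x -> ((ratr q)%:E < f x <-> AZ.1 x)].
  have mq : measurable `](ratr q : R)%:E, +oo[%classic by exact: emeasurable_itv.
  have [A mA [N [Z [mZ Z0 NZ]] fAN]] := mf _ mq.
  exists (A, Z); split => //= x Zx.
  have : (f @^-1` `](ratr q : R)%:E, +oo[) x <-> (A `|` N) x by rewrite fAN.
  rewrite /= in_itv /= andbT => ->; split=> [[//|/NZ]|Ax]; last by left.
  by move=> /Zx.
exists (\bigcup_q (A q).2); split.
- apply: countable_bigcupT_measurable => [|q]; first exact: countableP.
  by case: (AP q).
- apply/negligibleP; first by apply: countable_bigcupT_measurable => [|q];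
    [exact: countableP|case: (AP q)].
  apply: negligible_countable_bigcup => q; have [_ mZ Z0 _] := AP q.
  by exists (A q).2; split.
have mZ : measurable (\bigcup_q (A q).2).
  by apply: countable_bigcupT_measurable => [|q]; [exact: countableP|case: (AP q)].
move=> mD; apply: (measurability _ (ErealGenOInfty.measurableE R)) => // _ [_ [r ->] <-].
rewrite (_ : _ `&` _ = ~` (\bigcup_q (A q).2) `&`
    (\bigcup_q (if (r < ratr q)%R then (A q).1 else set0))).
  apply: measurableI => //; apply: countable_bigcupT_measurable => [|q]; first exact: countableP.
  by case: ifP => // _; case: (AP q).
apply/seteqP; split=> x [xZ] /=.
  rewrite in_itv /= andbT => rf; split => //.
  have [q rq qf] : exists2 q : rat, (r < ratr q)%R & (ratr q)%:E < f x.
    have [p [q [pq rp qf]]] := ereal_rat_between_fin rf.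
    by exists q => //; apply: (lt_trans rp); rewrite ltr_rat.
  exists q => //; rewrite rq; have [_ _ _ h] := AP q.
  by apply/h => // Zx; apply: xZ; exists q.
move=> [q _]; case: ifP => // rq Ax; split => //; rewrite in_itv /= andbT.
have [_ _ _ h] := AP q; apply: (@lt_trans _ _ (ratr q)%:E); first by rewrite lte_fin.
by apply/h => // Zx; apply: xZ; exists q.
Qed.

Lemma measurable_off_null_completed dY (Y : measurableType dY) (f : T -> Y) Z :
  measurable Z -> mu Z = 0 -> measurable_fun (~` Z) f ->
  forall B, measurable B -> completed_algebra_gen mu (f @^-1` B).
Proof.
move=> mZ Z0 mf B mB; exists (~` Z `&` f @^-1` B).
  by apply: mf => //; exact: measurableC.
exists (Z `&` f @^-1` B); first by exists Z; split => // x [].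
by rewrite -setIUl setUC setUv setTI.
Qed.

End measurable_off_null.

Lemma esub_ge0 (R : realType) (x y : \bar R) : y <= x -> 0 <= esub x y.
Proof. by case: x y => [x| |] [y| |] //= yx; rewrite ?lee_fin ?subr_ge0 // leey. Qed.

(** In the library's sum [-oo] prevails over [+oo]; negating the reversed difference therefore
    produces the convention that both indeterminate differences are [+oo], and measurability follows
    from that of the usual difference. *)
Lemma esubE (R : realType) (x y : \bar R) : esub x y = - (y - x).
Proof.
by case: x y => [x| |] [y| |] //=; congr (_%:E); rewrite opprB.
Qed.

Lemma measurable_esub dT (T : measurableType dT) (R : realType) (D : set T) (f g : T -> \bar R) :
  measurable_fun D f -> measurable_fun D g -> measurable_fun D (fun x => esub (f x) (g x)).
Proof.
move=> mf mg; rewrite (_ : (fun x => _) = (fun x => - (g x - f x))).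
  by apply: measurableT_comp => //; exact: emeasurable_funB.
by apply/funext => x; rewrite esubE.
Qed.

(** * Conditioned and stopped test plans *)

Section stopped_plan.
Context (R : realType) (M : ptopologicalType) (l : time_separation R M).
Context (m : {measure set (borel M) -> \bar R}) (d : M -> M -> R).
Hypotheses (dd : is_distance d) (dtop : induces_topology d).
Context (C : R) (dC : forall x y, (d x y <= C)%R).
Context (xd : nat -> M)
  (xdP : forall x (e : R), (0 < e)%R -> exists k, (d (xd k) x < e)%R).
Context (s t : R).
Hypotheses (s0 : (0 <= s)%R) (st : (s < t)%R) (t1 : (t <= 1)%R).

Lemma stop_clamp (c : LCC l) r :
  stop c s t r = stop c s t (Num.max 0 (Num.min r 1))%R.
Proof.
rewrite /stop /=; congr (c _); rewrite /stop_time.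
have [r0|] := boolP (r <= 0)%R.
  rewrite (min_idPl (_ : r <= 1)%R) ?(le_trans r0) // (max_idPl r0).
  rewrite (min_idPl _); last by rewrite (le_trans r0) // (le_trans s0) // ltW.
  rewrite (min_idPl _); last by rewrite (le_trans s0) // ltW.
  by rewrite !max_l // (le_trans r0).
rewrite -ltNge => r0; have [r1|] := boolP (r <= 1)%R.
  by rewrite (min_idPl r1) (max_idPr (ltW r0)).
rewrite -ltNge => r1; rewrite (min_idPr (ltW r1)) (max_idPr ler01) (min_idPr t1) (min_idPr _) //.
by rewrite (le_trans t1) // ltW.
Qed.

Lemma stop_left_continuous (c : LCC l) r : (0 < r)%R -> (r <= 1)%R ->
  stop c s t x @[x --> r^'-] --> stop c s t r.
Proof.
move=> _ _; have [rs|sr] := leP r s.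
  apply: cvg_near_cst; near=> x.
  have xr : (x < r)%R by near: x; exact: nbhs_left_lt.
  by rewrite /stop /= !stop_time_le // (le_trans (ltW xr)).
have [tr|rt] := ltP t r.
  apply: cvg_near_cst; near=> x.
  have tx : (t < x)%R by near: x; exact: nbhs_left_gt.
  by rewrite /stop /= !stop_time_ge // ltW.
rewrite {2}/stop /= stop_time_id ?(ltW sr) //.
have h := @LCC_left_continuous R M l c r.
apply: (cvg_trans _ h); apply: near_eq_cvg; near=> x.
have xr : (x < r)%R by near: x; exact: nbhs_left_lt.
have sx : (s < x)%R by near: x; exact: nbhs_left_gt.
by rewrite /stop /= stop_time_id // (ltW sx) (le_trans (ltW xr)).
Unshelve. all: by end_near. Qed.

Definition stop_LCC (c : LCC l) : LCC l :=
  MkLCC (stop_clamp c)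
    (fun r r' _ rr _ => stop_causal s0 st t1 (@curve_causal _ _ _ c) rr)
    (stop_left_continuous (c := c)).

Lemma measurable_stop_LCC :
  measurable_fun setT (stop_LCC : borel_LCC l d -> borel_LCC l d).
Proof.
apply: (measurable_LCC_map dd dtop dC xdP) => q.
exact: (measurable_eval dd dtop dC xdP (stop_time s t q)).
Qed.

Definition stop_mfun : {mfun borel_LCC l d >-> borel_LCC l d} :=
  mfun_Sub (mem_set measurable_stop_LCC).

(** [pi] is conditioned on [B], then pushed forward by stopping. The second argument of [mnormalize]
    is a fallback for total mass 0, which the lemmas below exclude by assuming [pi B != 0]. *)
Definition stopped_plan (pi : probability (borel_LCC l d) R) (B : set (borel_LCC l d))
    (mB : measurable B) : probability (borel_LCC l d) R :=
  distribution (mnormalize (mrestr pi mB) pi : probability (borel_LCC l d) R) stop_mfun.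

Lemma stopped_planE (pi : probability (borel_LCC l d) R) (B : set (borel_LCC l d))
  (mB : measurable B) (U : set (borel_LCC l d)) : pi B != 0 -> measurable U ->
  stopped_plan pi mB U = pi (stop_LCC @^-1` U `&` B) * (fine (pi B))^-1%:E.
Proof.
move=> B0 mU; rewrite /stopped_plan /= /distribution /pushforward /mnormalize /=.
rewrite /mrestr setTI (negbTE B0) /=.
by rewrite (_ : (pi B == +oo) = false) //; apply/negbTE; rewrite -ltey probability_lty.
Qed.

Lemma stopped_plan_test (pi : probability (borel_LCC l d) R) (B : set (borel_LCC l d))
  (mB : measurable B) : pi B != 0 -> test_plan m pi ->
  test_plan m (stopped_plan pi mB).
Proof.
move=> B0 [K K0 piK].
have B0' : (0 < fine (pi B))%R.
  by rewrite fine_gt0 // lt0e B0 measure_ge0 /= probability_lty.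
(* Conditioning costs the factor 1 / pi(B); stopping costs nothing, since the position at time r is
   that of the original curve at [stop_time s t r]. *)
exists (K / fine (pi B))%R; first by rewrite divr_gt0.
move=> r r01 A mA; rewrite /pushforward.
have mev := measurable_eval dd dtop dC xdP (l := l).
rewrite stopped_planE //; last by rewrite -[X in measurable X]setTI; exact: (mev r).
rewrite EFinM -muleA (muleC _%:E (m A)) muleA lee_wpmul2r //.
  by rewrite lee_fin invr_ge0 ltW.
have /andP[h1 h2] := stop_time_itv st r.
have h3 : (0 <= stop_time s t r <= 1)%R by rewrite (le_trans s0) // (le_trans h2).
apply: le_trans (piK _ h3 A mA); apply: measure_subset.
- apply: measurableI => //; rewrite -[X in measurable X]setTI.
  exact: (mev (stop_time s t r)).
- by rewrite -[X in measurable X]setTI; exact: (mev (stop_time s t r)).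
- by move=> c [].
Qed.

End stopped_plan.

Section speed_along_plans.
Context (R : realType) (M : ptopologicalType) (l : time_separation R M).
Context (m : {measure set (borel M) -> \bar R}) (d : M -> M -> R).
Hypotheses (dd : is_distance d) (dtop : induces_topology d).
Context (C : R) (dC : forall x y, (d x y <= C)%R).
Context (xd : nat -> M)
  (xdP : forall x (e : R), (0 < e)%R -> exists k, (d (xd k) x < e)%R).
Local Notation leb := (@lebesgue_measure R).
Local Notation plan := (probability (borel_LCC l d) R).

Let mev q := measurable_eval (l := l) dd dtop dC xdP q.

Let measurable_ev q (A : set (borel M)) : measurable A ->
  measurable ([set c | A (c q)] : set (borel_LCC l d)).
Proof. by move=> mA; rewrite -[X in measurable X]setTI; exact: (mev q). Qed.

Lemma LCC_causal (c : LCC l) r r' : (r <= r')%R -> causal_le l (c r) (c r').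
Proof.
move=> rr; rewrite (curve_clamp c r) (curve_clamp c r'); apply: curve_causal.
- by rewrite le_max lexx.
- by rewrite le_max2 // le_min2.
- by rewrite ge_max ler01 ge_min lexx orbT.
Qed.

Lemma test_plan_null (pi : plan) (Z : set (borel M)) (q : R) : test_plan m pi ->
  (0 <= q <= 1)%R -> measurable Z -> m Z = 0 -> pi [set c | Z (c q)] = 0.
Proof.
move=> [K K0 piK] q01 mZ Z0; apply/eqP; rewrite eq_le measure_ge0 andbT.
by have := piK q q01 Z mZ; rewrite Z0 mule0.
Qed.

(** At each fixed time the plan does not charge [Z]; Tonelli exchanges the order of curve and
    time. *)
Lemma test_plan_ae_null (pi : plan) (Z : set (borel M)) : test_plan m pi ->
  measurable Z -> m Z = 0 ->
  {ae pi, forall c : borel_LCC l d, {ae leb, forall r, `[0%R, 1%R]%classic r -> ~ Z (c r)}}.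
Proof.
move=> piP mZ Z0.
have mj := measurable_left_continuous dd dtop xdP
  (fun (c : borel_LCC l d) t => @LCC_left_continuous _ _ _ (c : LCC l) t) mev.
pose h (p : borel_LCC l d * measurableTypeR R) : \bar R :=
  (\1_(`[0%R, 1%R]%classic) p.2 * \1_Z (p.1 p.2 : borel M))%:E.
have mh : measurable_fun setT h.
  apply/measurable_EFinP; apply: measurable_funM.
    by apply: measurableT_comp => //; exact: measurable_indic.
  have mi : measurable_fun setT (\1_Z : borel M -> R) by apply: measurable_indic.
  exact: (measurableT_comp mi mj).
have h0 p : 0 <= h p by rewrite lee_fin mulr_ge0.
have := fubini_tonelli (m1 := pi) (m2 := leb) h mh h0.
rewrite [X in _ = X](_ : _ = 0); last first.
  apply: integral0_eq => r _; rewrite /h /=.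
  have [r01|r01] := boolP (r \in `[0%R, 1%R]%classic); last first.
    by apply: integral0_eq => c _; rewrite indicE (negbTE r01) mul0r.
  under eq_integral => c _ do rewrite indicE r01 mul1r.
  rewrite [LHS](_ : _ = \int[pi]_c (\1_([set c : LCC l | Z (c r)]) c)%:E).
    rewrite integral_indic ?setIT //; last exact: measurable_ev.
    by apply: (test_plan_null piP) => //; move: r01; rewrite inE /= in_itv.
  by apply: eq_integral => c _; rewrite !indicE; congr (_%:R%:E); congr nat_of_bool; apply/idP/idP; rewrite !inE.
move=> int0.
have mF : measurable_fun setT (fun c : borel_LCC l d => \int[leb]_r h (c, r)).
  exact: (measurable_fun_fubini_tonelli_F h mh h0).
have int0' : \int[pi]_c `|\int[leb]_r h (c, r)| = 0.
  by rewrite -int0; apply: eq_integral => c _; rewrite gee0_abs // integral_ge0.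
have [N [mN N0 hN]] := (ae_eq_integral_abs pi measurableT mF).1 int0'.
exists N; split => // c nc; apply: hN => /= hc; apply: nc => /=.
have mhc : measurable_fun setT (fun r : measurableTypeR R => h (c, r)).
  by apply: (measurableT_comp mh); exact: pair1_measurable.
have hc0 : \int[leb]_r `|h (c, r)| = 0.
  by rewrite -[RHS](hc Logic.I); apply: eq_integral => r _; rewrite gee0_abs.
have [N' [mN' N'0 hN']] := (ae_eq_integral_abs leb measurableT mhc).1 hc0.
exists N'; split => // r nr; apply: hN' => /= hr; apply: nr => /= r01 Zr.
have := hr Logic.I; rewrite /h /= !indicE !mem_set // mulr1 => /eqP.
by rewrite eqe oner_eq0.
Qed.

Context (f G : M -> \bar R).
Hypotheses (f_causal : causal_function l m f).
Hypothesis fG : weak_subslope l m d f G.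

Let G0 x : 0 <= G x. Proof. by case: fG. Qed.

Let measurable_speed_integrand (c : LCC l) :
  measurable_fun setT (fun r : measurableTypeR R => G (c r)).
Proof.
case: fG => mG _ _.
exact: (measurableT_comp mG (measurable_LCC dd dtop xdP c)).
Qed.

Section slab.
Context (pi : plan) (s t : R).
Hypothesis piP : test_plan m pi.
Hypotheses (s0 : (0 <= s)%R) (st : (s < t)%R) (t1 : (t <= 1)%R).
Let Phi (c : LCC l) := \int[leb]_(r in `]s, t[) (G (c r) * causal_speed l c r).
Let Psi (c : LCC l) := esub (f (c t)) (f (c s)).

Let Psi0 c : 0 <= Psi c.
Proof. by apply: esub_ge0; apply: f_causal.2; apply: LCC_causal; exact: ltW. Qed.

Let Phi_stop c : Phi c <= \int[leb]_(r in `[0%R, 1%R])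
  (G (stop_LCC s0 st t1 c r) * causal_speed l (stop_LCC s0 st t1 c) r).
Proof.
have h := @causal_speed_stop R M l c s t (fun r => G (stop c s t r)) s0 st t1
  (fun r r' _ rr _ => @LCC_causal c r r' rr)
  (measurable_speed_integrand (stop_LCC s0 st t1 c)) (fun r => G0 _).
apply: le_trans h; rewrite le_eqVlt; apply/orP; left; apply/eqP.
apply: eq_integral => r; rewrite inE /= in_itv /= => /andP[sr rt].
by rewrite /stop /= stop_time_id // !ltW.
Qed.

(* The stopped plan built from [B] has an upper integral of the speed below p, so
   Markov's inequality for a measurable majorant covers {Phi > q} by a strictly
   smaller set. *)
Let markov_step (p q : rat) (B : set (borel_LCC l d)) :
  (0 <= ratr p :> R)%R -> (p < q)%R -> measurable B ->
  (forall c, B c -> Psi c <= (ratr p)%:E) ->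
  exists B' : set (borel_LCC l d), [/\ measurable B',
    B `&` [set c | (ratr q)%:E < Phi c] `<=` B', B' `<=` B &
    pi B' <= ((ratr p + ratr q) / 2 / ratr q)%:E * pi B].
Proof.
move=> p0 pq mB BP.
have pqR : (ratr p < ratr q :> R)%R by rewrite ltr_rat.
have q0 : (0 < ratr q :> R)%R by exact: le_lt_trans pqR.
have [B0|B0] := eqVneq (pi B) 0.
  by exists B; split => //; rewrite B0 mule0.
pose pi' := stopped_plan dd dtop dC xdP s0 st t1 pi mB.
have pi'P : test_plan m pi' by exact: stopped_plan_test.
have pi'E U : measurable U ->
    pi' U = pi (stop_LCC s0 st t1 @^-1` U `&` B) * (fine (pi B))^-1%:E.
  by move=> mU; exact: stopped_planE.
have [Z [mZ Z0 mfZ]] := completed_measurable_off_null f_causal.1.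
(* A bound strictly below the midpoint is needed: the infimum defining the upper integral then
   provides a measurable majorant [h] with integral below (p + q) / 2, and Markov's inequality at
   level q gives the factor (p + q) / (2 q). *)
have : speed_integral pi' G < ((ratr p + ratr q) / 2)%:E.
  have [_ _ /(_ pi' pi'P) h] := fG; apply: (le_lt_trans h).
  apply: (@le_lt_trans _ _ (ratr p)%:E); last by rewrite lte_fin midf_lt.
  pose V := [set c : borel_LCC l d | (~` Z) (c 0%R)] `&` [set c : borel_LCC l d | (~` Z) (c 1%R)].
  have mV : measurable V.
    exact: (measurableI _ _ (measurable_ev 0%R (measurableC mZ)) (measurable_ev 1%R (measurableC mZ))).
  pose E := V `&` [set c | esub (f (c 1%R)) (f (c 0%R)) <= (ratr p)%:E].
  have mE : measurable E.
    apply: (@emeasurable_fun_infty_c _ _ _ V (fun c : borel_LCC l d => esub (f (c 1%R)) (f (c 0%R)))) => //.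
    apply: measurable_esub.
      apply: (@measurable_comp _ _ _ _ _ _ (~` Z) f V (fun c : borel_LCC l d => c 1%R : borel M)) => //.
      - exact: measurableC.
      - by move=> _ [c [_ Vc] <-].
      - exact: measurable_funTS (mev 1%R).
    apply: (@measurable_comp _ _ _ _ _ _ (~` Z) f V (fun c : borel_LCC l d => c 0%R : borel M)) => //.
    - exact: measurableC.
    - by move=> _ [c [Vc _] <-].
    - exact: measurable_funTS (mev 0%R).
  apply: (@ge0_integral_le_cst _ _ _ _ _ _ (~` E)) => //.
  - exact: measurableC.
  - rewrite pi'E; last exact: measurableC.
    rewrite [X in X * _](_ : _ = 0) ?mul0e //.
    (* A stopped curve starts at [c s] and ends at [c t]. For c in [B] the increment bound holds, so
       the stopped curve can leave [E] only if one of these points lies in [Z]. *)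
    apply: (@measure0_subset _ _ _ pi _ ([set c | Z (c s)] `|` [set c | Z (c t)])).
    + apply: measurableI => //; rewrite -[X in measurable X]setTI.
      by apply: (measurable_stop_LCC dd dtop dC xdP) => //; exact: measurableC.
    + by apply: measurableU; exact: measurable_ev.
    + move=> c [/= nE Bc]; apply: contrapT => nZ; apply: nE.
      have e0 : stop_LCC s0 st t1 c 0%R = c s by rewrite /= /stop /= stop_time_le.
      have e1 : stop_LCC s0 st t1 c 1%R = c t by rewrite /= /stop /= stop_time_ge.
      split; last by rewrite /mkset e0 e1; exact: BP.
      by split; rewrite /mkset ?e0 ?e1 => Zc; apply: nZ; [left|right].
    + rewrite null_set_setU //; try exact: measurable_ev.
        by apply: (test_plan_null piP) => //; rewrite s0 (le_trans (ltW st)).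
      by apply: (test_plan_null piP) => //; rewrite t1 (le_trans s0 (ltW st)).
  - by move=> c; apply: esub_ge0; apply: f_causal.2; exact: LCC_causal.
  - by move=> c /contrapT[].
move=> /ereal_inf_lt[_ [h [mh hP] <-] hlt].
have h0 c : 0 <= h c.
  apply: le_trans (hP c); apply: integral_ge0 => r _.
  by rewrite mule_ge0 // causal_speed_ge0.
pose W := [set c | (ratr q)%:E <= h c].
have mW : measurable W.
  by rewrite -[X in measurable X]setTI; exact: emeasurable_fun_c_infty.
have mSW : measurable (stop_LCC s0 st t1 @^-1` W : set (borel_LCC l d)).
  by rewrite -[X in measurable X]setTI; apply: (measurable_stop_LCC dd dtop dC xdP).
exists (stop_LCC s0 st t1 @^-1` W `&` B); split.
- exact: measurableI.
- move=> c [Bc /= qc]; split => //; rewrite /W /=.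
  exact: le_trans (ltW qc) (le_trans (Phi_stop c) (hP _)).
- by move=> c [].
have qW : (ratr q)%:E * pi' W <= ((ratr p + ratr q) / 2)%:E.
  apply: le_trans (ltW hlt); rewrite -integral_cst //.
  apply: (@le_trans _ _ (\int[pi']_(c in W) h c)).
    apply: ge0_le_integral => //.
    - by move=> c _; rewrite lee_fin ltW.
    - exact: measurable_funTS.
  by apply: ge0_subset_integral.
have Bfin : pi B \is a fin_num by rewrite ge0_fin_numE // probability_lty.
have mWB : measurable (stop_LCC s0 st t1 @^-1` W `&` B : set (borel_LCC l d)) by exact: measurableI.
have WBfin : pi (stop_LCC s0 st t1 @^-1` W `&` B) \is a fin_num.
  by rewrite ge0_fin_numE // probability_lty.
have B0' : (0 < fine (pi B))%R.
  by rewrite fine_gt0 // lt0e B0 measure_ge0 /= probability_lty.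
move: qW; rewrite pi'E // -(fineK WBfin) -(fineK Bfin) -!EFinM !lee_fin.
rewrite mulrA ler_pdivrMr // => qW.
by rewrite (mulrAC _ (ratr q)^-1%R) ler_pdivlMr // mulrC.
Qed.

(** For rationals p < q, [markov_step] shrinks any Borel cover of the set where [Psi <= p] and
    [Phi > q] by a fixed factor less than 1, and [negligible_contraction] concludes. Working with
    covers is what replaces the measurability of [Phi]. *)
Lemma speed_integral_slab : {ae pi, forall c : borel_LCC l d,
  \int[leb]_(r in `]s, t[) (G (c r) * causal_speed l c r) <= esub (f (c t)) (f (c s))}.
Proof.
have [Z [mZ Z0 mfZ]] := completed_measurable_off_null f_causal.1.
have : {ae pi, forall c, [set: borel_LCC l d] c -> Phi c <= Psi c}.
  apply: ae_le_rat => // p q pq; rewrite setTI.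
  have [p0|p0] := ltP (ratr p : R) 0%R.
    rewrite (_ : _ `&` _ = set0); first exact: negligible_set0.
    rewrite -subset0 => c [/= cp _].
    by have := le_trans (Psi0 c) cp; rewrite lee_fin leNgt p0.
  pose V := [set c : borel_LCC l d | (~` Z) (c s)] `&` [set c : borel_LCC l d | (~` Z) (c t)].
  have mV : measurable V.
    exact: (measurableI _ _ (measurable_ev s (measurableC mZ)) (measurable_ev t (measurableC mZ))).
  pose B0 := V `&` [set c | Psi c <= (ratr p)%:E].
  have mB0 : measurable B0.
    apply: (@emeasurable_fun_infty_c _ _ _ V Psi) => //.
    apply: measurable_esub.
      apply: (@measurable_comp _ _ _ _ _ _ (~` Z) f V (fun c : borel_LCC l d => c t : borel M)) => //.
      - exact: measurableC.
      - by move=> _ [c [_ Vc] <-].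
      - exact: measurable_funTS (mev t).
    apply: (@measurable_comp _ _ _ _ _ _ (~` Z) f V (fun c : borel_LCC l d => c s : borel M)) => //.
    - exact: measurableC.
    - by move=> _ [c [Vc _] <-].
    - exact: measurable_funTS (mev s).
  (* [B0] only contains curves avoiding [Z] at the times s and t, where [Psi] is measurable; the
     other curves form a null set and are added separately. *)
  pose N : set (borel_LCC l d) := B0 `&` [set c | (ratr q)%:E < Phi c] `|`
    ([set c : borel_LCC l d | Z (c s)] `|` [set c : borel_LCC l d | Z (c t)]).
  apply: (@negligibleS _ _ _ pi N).
    move=> c [/= cp cq]; have [Zs|Zs] := pselect (Z (c s)); first by right; left.
    have [Zt|Zt] := pselect (Z (c t)); first by right; right.
    by left; split.
  apply: negligibleU; last first.
    apply: negligibleU; apply/negligibleP; try exact: measurable_ev.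
      by apply: (test_plan_null piP) => //; rewrite s0 (le_trans (ltW st)).
    by apply: (test_plan_null piP) => //; rewrite t1 (le_trans s0 (ltW st)).
  have pqR : (ratr p < ratr q :> R)%R by rewrite ltr_rat.
  have q0 : (0 < ratr q :> R)%R by exact: le_lt_trans pqR.
  apply: (@negligible_contraction _ _ _ _ _ B0 ((ratr p + ratr q) / 2 / ratr q)%R) => //.
  - rewrite divr_ge0 ?(ltW q0) ?divr_ge0 ?addr_ge0 ?(ltW q0) //=.
    by rewrite ltr_pdivrMr // mul1r midf_lt.
  - move=> B mB EB BB0.
    have [c Bc|B' [mB' EB' B'B PB']] := @markov_step p q B p0 pq mB.
      by have [_] := BB0 _ Bc.
    exists B'; split => // c [B0c qc]; apply: EB'; split => //.
    by apply: EB; split.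
by case=> N [mN N0 hN]; exists N; split => // c nc; apply: hN => /= h; apply: nc; exact: h.
Qed.

End slab.
End speed_along_plans.

(** * The Leibniz rule *)

Section leibniz_rule.
Context (R : realType) (M : ptopologicalType) (l : time_separation R M).
Context (m : {measure set (borel M) -> \bar R}) (d : M -> M -> R).

Lemma polish_dense_sequence : polish R M -> is_distance d -> induces_topology d ->
  exists xd : nat -> M, forall x (e : R), (0 < e)%R -> exists k, (d (xd k) x < e)%R.
Proof.
move=> [[S cS dS] _] dd dtop.
have [xd Sxd] : exists xd : nat -> M, S `<=` range xd.
  have [x0 _] : S !=set0.
    have [x [_ Sx]] := dS setT (ex_intro _ point Logic.I) openT; by exists x.
  by have /pcard_leP/unsquash f := cS; exists (fun n => odflt point ('oinv_f n)) => x Sx;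
    exists (f x) => //=; rewrite funoK //= inE.
exists xd => x e e0.
have oB : open [set y | d x y < e]%R by exact: open_dist_lt.
have nB : [set y | d x y < e]%R !=set0 by exists x; rewrite /= distxx.
have [y [/= xy /Sxd[k _ kx]]] := dS _ nB oB.
by exists k; rewrite kx distC.
Qed.

Hypotheses (dd : is_distance d) (dtop : induces_topology d).
Context (C : R) (dC : forall x y, (d x y <= C)%R).
Context (xd : nat -> M)
  (xdP : forall x (e : R), (0 < e)%R -> exists k, (d (xd k) x < e)%R).
Local Notation leb := (@lebesgue_measure R).
Context (f g : M -> \bar R).
Hypotheses (f0 : forall x, 0 <= f x) (f_causal : causal_function l m f).
Hypotheses (g0 : forall x, 0 <= g x) (g_causal : causal_function l m g).

Lemma causal_functionM : causal_function l m (fun x => f x * g x).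
Proof.
split; last by move=> x y xy; apply: lee_pmul => //; [exact: f_causal.2|exact: g_causal.2].
have [Z [mZ Z0 mfZ]] := completed_measurable_off_null f_causal.1.
have [Z' [mZ' Z'0 mgZ]] := completed_measurable_off_null g_causal.1.
apply: (@measurable_off_null_completed _ _ _ m _ _ _ (Z `|` Z')).
- exact: measurableU.
- by rewrite null_set_setU.
- rewrite setCU; apply: emeasurable_funM.
    exact: (measurable_funS (measurableC mZ) (@subIsetl _ _ _) mfZ).
  exact: (measurable_funS (measurableC mZ') (@subIsetr _ _ _) mgZ).
Qed.

Context (Df Dg : M -> \bar R).
Hypotheses (fDf : weak_subslope l m d f Df) (gDg : weak_subslope l m d g Dg).

Let tk_itv n k : (k < n.+1)%N -> let s := (k%:R / n.+1%:R : R)%R in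
  let t := (k.+1%:R / n.+1%:R : R)%R in [/\ (0 <= s)%R, (s < t)%R & (t <= 1)%R].
Proof.
move=> kn /=; split; first by rewrite divr_ge0.
  by rewrite ltr_pM2r ?invr_gt0 // ltr_nat.
by rewrite ler_pdivrMr // mul1r ler_nat.
Qed.

Let slabs (pi : probability (borel_LCC l d) R) (h Dh : M -> \bar R) :
  test_plan m pi -> causal_function l m h -> weak_subslope l m d h Dh ->
  {ae pi, forall c : borel_LCC l d, forall n k, (k < n.+1)%N ->
    \int[leb]_(r in `](k%:R / n.+1%:R)%R, (k.+1%:R / n.+1%:R)%R[) (Dh (c r) * causal_speed l c r)
    <= esub (h (c (k.+1%:R / n.+1%:R)%R)) (h (c (k%:R / n.+1%:R)%R))}.
Proof.
move=> piP hc hD.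
have H (p : nat * nat) : pi.-negligible [set c : borel_LCC l d | ~ ((p.2 < p.1.+1)%N ->
    \int[leb]_(r in `](p.2%:R / p.1.+1%:R)%R, (p.2.+1%:R / p.1.+1%:R)%R[) (Dh (c r) * causal_speed l c r)
    <= esub (h (c (p.2.+1%:R / p.1.+1%:R)%R)) (h (c (p.2%:R / p.1.+1%:R)%R)))].
  have [pn|pn] := boolP (p.2 < p.1.+1)%N; last first.
    apply: negligibleS (negligible_set0 pi) => c /= nc.
    by apply: nc => pn'.
  have [s0 st t1] := tk_itv pn.
  have := speed_integral_slab dd dtop dC xdP hc hD piP s0 st t1.
  by apply: negligibleS => c /= nc hcc; apply: nc.
have := negligible_countable_bigcup H; apply: negligibleS => c /= nc.
apply: contrapT => nn; apply: nc => n k kn; apply: contrapT => hn.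
by apply: nn; exists (n, k) => //= h'; exact: hn (h' kn).
Qed.

(** [H] may be altered on [Z] because almost every curve meets [Z] only for a null set of times. The
    same holds for the end points, which almost surely lie off [Z]; there the increment of the
    product is measurable. *)
Lemma weak_subslopeM (Z : set (borel M)) (H : M -> \bar R) :
  measurable Z -> m Z = 0 -> measurable_fun (~` Z) f -> measurable_fun (~` Z) g ->
  measurable_fun setT (H : borel M -> \bar R) -> (forall x, 0 <= H x) ->
  (forall x, ~ Z x -> H x = f x * Dg x + g x * Df x) ->
  weak_subslope l m d (fun x => f x * g x) H.
Proof.
move=> mZ Z0 mfZ mgZ mH H0 HE; split => // pi piP.
have mev q := measurable_eval (l := l) dd dtop dC xdP q.
have measurable_ev q (A : set (borel M)) : measurable A ->
    measurable ([set c | A (c q)] : set (borel_LCC l d)).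
  by move=> mA; rewrite -[X in measurable X]setTI; exact: (mev q).
have Df0 x : 0 <= Df x by case: fDf.
have Dg0 x : 0 <= Dg x by case: gDg.
have mDf : measurable_fun setT (Df : borel M -> \bar R) by case: fDf.
have mDg : measurable_fun setT (Dg : borel M -> \bar R) by case: gDg.
pose Psi (c : borel_LCC l d) := esub (f (c 1%R) * g (c 1%R)) (f (c 0%R) * g (c 0%R)).
have Psi0 c : 0 <= Psi c.
  by apply: esub_ge0; apply: causal_functionM.2; exact: LCC_causal.
pose Phi (c : borel_LCC l d) := \int[leb]_(r in `[0%R, 1%R]) (H (c r) * causal_speed l c r).
have [N1 [mN1 N10 hN1]] := slabs piP f_causal fDf.
have [N2 [mN2 N20 hN2]] := slabs piP g_causal gDg.
have [N3 [mN3 N30 hN3]] := test_plan_ae_null dd dtop dC xdP piP mZ Z0.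
pose W : set (borel_LCC l d) := [set c | Z (c 0%R)] `|` [set c | Z (c 1%R)].
have mW : measurable W by apply: measurableU; apply: measurable_ev.
have W0 : pi W = 0.
  have Z1 (q : R) : (0 <= q <= 1)%R -> pi [set c | Z (c q)] <= 0.
    by move=> q01; rewrite (test_plan_null piP).
  apply/eqP; rewrite eq_le measure_ge0 andbT.
  apply: (le_trans (measure_setU_le pi (measurable_ev 0%R _ mZ) (measurable_ev 1%R _ mZ))).
  by rewrite -[leRHS]adde0; apply: leeD; apply: Z1; rewrite ?lexx ?ler01.
pose N := N1 `|` N2 `|` N3 `|` W.
have mN : measurable N by do 3 apply: measurableU => //.
have N0 : pi N = 0.
  have m12 := measurableU _ _ mN1 mN2.
  have N120 := null_set_setU mN1 mN2 N10 N20.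
  have N1230 := null_set_setU m12 mN3 N120 N30.
  exact: (null_set_setU (measurableU _ _ m12 mN3) mW N1230 W0).
have le_off c : ~ N c -> Phi c <= Psi c.
  move=> nN.
  have h1 : forall n k, (k < n.+1)%N ->
      \int[leb]_(r in `](k%:R / n.+1%:R)%R, (k.+1%:R / n.+1%:R)%R[) (Df (c r) * causal_speed l c r)
      <= esub (f (c (k.+1%:R / n.+1%:R)%R)) (f (c (k%:R / n.+1%:R)%R)).
    by apply: contrapT => nh; apply: nN; left; left; left; exact: hN1.
  have h2 : forall n k, (k < n.+1)%N ->
      \int[leb]_(r in `](k%:R / n.+1%:R)%R, (k.+1%:R / n.+1%:R)%R[) (Dg (c r) * causal_speed l c r)
      <= esub (g (c (k.+1%:R / n.+1%:R)%R)) (g (c (k%:R / n.+1%:R)%R)).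
    by apply: contrapT => nh; apply: nN; left; left; right; exact: hN2.
  have h3 : {ae leb, forall r, `[0%R, 1%R]%classic r -> ~ Z (c r)}.
    by apply: contrapT => nh; apply: nN; left; right; exact: hN3.
  have mc (h : M -> \bar R) : measurable_fun setT (h : borel M -> \bar R) ->
      measurable_fun setT (fun r : measurableTypeR R => h (c r) * causal_speed l c r).
    move=> mh; apply: emeasurable_funM; last exact: measurable_causal_speed.
    exact: (measurableT_comp mh (measurable_LCC dd dtop xdP c)).
  apply: (@leibniz_curve R (fun r => f (c r)) (fun r => g (c r))
    (fun r => Df (c r) * causal_speed l c r) (fun r => Dg (c r) * causal_speed l c r)) => //.
  - by move=> r r' rr; apply: f_causal.2; exact: LCC_causal.
  - by move=> r r' rr; apply: g_causal.2; exact: LCC_causal.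
  - by move=> r; rewrite mule_ge0 // causal_speed_ge0.
  - by move=> r; rewrite mule_ge0 // causal_speed_ge0.
  - exact: mc.
  - exact: mc.
  - exact: mc.
  - by move=> r; rewrite mule_ge0 // causal_speed_ge0.
  - case: h3 => N' [mN' N'0 hN']; exists N'; split => // r nr; apply: hN' => /= hr; apply: nr => r01.
    rewrite HE; last exact: hr.
    by rewrite ge0_muleDl ?mule_ge0 // !muleA.
(* The measurable majorant of [Phi] that bounds the upper integral: on the null set [N], where
   nothing is known, the value [+oo] costs nothing. *)
pose h (c : borel_LCC l d) := if c \in N then +oo else Psi c.
rewrite /speed_integral.
have mPsi : measurable_fun (~` N) Psi.
  have sub q : q = 0%R \/ q = 1%R -> forall c : borel_LCC l d, (~` N) c -> (~` Z) (c q).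
    by move=> q01 c nN Zc; apply: nN; right; case: q01 Zc => ->; [left|right].
  have mcomp (k : M -> \bar R) q : q = 0%R \/ q = 1%R -> measurable_fun (~` Z) (k : borel M -> \bar R) ->
      measurable_fun (~` N) (fun c : borel_LCC l d => k (c q)).
    move=> q01 mk.
    apply: (@measurable_comp _ _ _ _ _ _ (~` Z) k (~` N) (fun c : borel_LCC l d => c q : borel M)) => //.
    - exact: measurableC.
    - by move=> _ [c Nc <-]; exact: (sub q q01 c Nc).
    - exact: measurable_funTS (mev q).
  have q0 : (0%R : R) = 0%R \/ (0%R : R) = 1%R by left.
  have q1 : (1%R : R) = 0%R \/ (1%R : R) = 1%R by right.
  apply: (measurable_esub (f := fun c : borel_LCC l d => f (c 1%R) * g (c 1%R))
    (g := fun c : borel_LCC l d => f (c 0%R) * g (c 0%R))).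
    exact: (emeasurable_funM (mcomp f _ q1 mfZ) (mcomp g _ q1 mgZ)).
  exact: (emeasurable_funM (mcomp f _ q0 mfZ) (mcomp g _ q0 mgZ)).
have mh : measurable_fun setT h.
  rewrite (_ : [set: borel_LCC l d] = N `|` ~` N); last by rewrite setUv.
  apply/measurable_funU => //; first exact: measurableC.
  split.
    apply: (eq_measurable_fun (cst +oo)); last exact: measurable_cst.
    by move=> c cN; rewrite /h cN.
  apply: (eq_measurable_fun Psi) => // c; rewrite inE /= => cN.
  by rewrite /h memNset.
have h0 c : 0 <= h c by rewrite /h; case: ifP.
apply: (@le_trans _ _ (\int[pi]_c h c)).
  apply: ereal_inf_lbound; exists h => //; split=> // c; rewrite /h.
  case: ifPn => [_|/negP cN]; first by rewrite leey.
  by apply: le_off => ?; apply: cN; rewrite inE.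
(* [Psi] is only known to be measurable off [N], so the last comparison relies on monotonicity of
   the integral without measurability. *)
apply: (@le_trans _ _ (\int[pi]_c (Psi \_ (~` N)) c)).
  have mR : measurable_fun setT (Psi \_ (~` N)).
    by apply/(measurable_restrictT _ (measurableC mN)).
  rewrite le_eqVlt; apply/orP; left; apply/eqP; apply: ge0_ae_eq_integral => //.
  - by move=> c _; rewrite /patch; case: ifP.
  - exists N; split => // c /= /not_implyP[_ nc]; apply: contrapT => cN; apply: nc.
    by rewrite /h memNset // /patch mem_set.
apply: ge0_le_integral_nonmeasurable.
  by move=> c; rewrite /patch; case: ifP.
by move=> c; rewrite /patch; case: ifP => _; [exact: lexx|exact: Psi0].
Qed.

End leibniz_rule.

Theorem proposition3p24 (R : realType) (M : ptopologicalType)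
    (l : time_separation R M) (m : {measure set (borel M) -> \bar R})
    (d : M -> M -> R)
    (mms : metric_measure_spacetime l m)
    (d_compatible : bounded_compatible_distance d)
    (f g : M -> \bar R)
    (f_ge0 : forall x, 0 <= f x) (f_causal : causal_function l m f)
    (g_ge0 : forall x, 0 <= g x) (g_causal : causal_function l m g) :
  causal_function l m (fun x => f x * g x) /\
  forall (Df Dg Dfg : M -> \bar R) (V : set (borel M)),
    largest_weak_subslope l m d f Df ->
    largest_weak_subslope l m d g Dg ->
    largest_weak_subslope l m d (fun x => f x * g x) Dfg ->
    is_Vis l m d V ->
    {ae m, forall x, V x -> f x * Dg x + g x * Df x <= Dfg x}.
Proof.
split; first exact: causal_functionM.
move=> Df Dg Dfg V [fDf _] [gDg _] [_ Dfg_max] _.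
have [polM _ _ _ _] := mms; have [dd dtop [C dC]] := d_compatible.
have [xd xdP] := polish_dense_sequence polM dd dtop.
have [Z1 [mZ1 Z10 mfZ1]] := completed_measurable_off_null f_causal.1.
have [Z2 [mZ2 Z20 mgZ2]] := completed_measurable_off_null g_causal.1.
pose Z := Z1 `|` Z2.
have mZ : measurable Z by exact: measurableU.
have Z0 : m Z = 0 by rewrite null_set_setU.
have mfZ : measurable_fun (~` Z) f.
  rewrite setCU; exact: (measurable_funS (measurableC mZ1) (@subIsetl _ _ _) mfZ1).
have mgZ : measurable_fun (~` Z) g.
  rewrite setCU; exact: (measurable_funS (measurableC mZ2) (@subIsetr _ _ _) mgZ2).
have [mDf Df0 _] := fDf; have [mDg Dg0 _] := gDg.
(* Setting the expression to 0 on the null set [Z] gives a Borel function that can compete with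
   [Dfg]. *)
pose H := (fun x => f x * Dg x + g x * Df x) \_ (~` Z).
have mH : measurable_fun setT (H : borel M -> \bar R).
  apply/(measurable_restrictT _ (measurableC mZ)).
  by apply: emeasurable_funD; apply: emeasurable_funM => //; exact: measurable_funTS.
have H0 x : 0 <= H x.
  by rewrite /H /patch; case: ifP => // _; rewrite adde_ge0 // mule_ge0.
have HE x : ~ Z x -> H x = f x * Dg x + g x * Df x.
  by move=> Zx; rewrite /H /patch mem_set.
have HD := Dfg_max _ (weak_subslopeM dd dtop dC xdP f_ge0 f_causal g_ge0 g_causal fDf gDg
  mZ Z0 mfZ mgZ mH H0 HE).
case: HD => N [mN N0 hN]; exists (Z `|` N); split.
- exact: measurableU.
- by rewrite null_set_setU.
move=> x /= nx; apply: contrapT => ZN; apply: nx => _.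
by rewrite -HE; [apply: contrapT => h; apply: ZN; right; exact: hN|move=> Zx; apply: ZN; left].
Qed.
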